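(* Let $X\in\mathbb{R}^7$ with $n(X)=1$, let $\mathbb{S}^6=\{Y\in\mathbb{R}^7:n(Y)=1\}$ and identify $T_X\mathbb{S}^6=X^\perp$. The linear map $$J\colon T_X\mathbb{S}^6\to T_X\mathbb{S}^6,\qquad J(Y)=X\times Y,$$ satisfies $J^2=-\mathrm{id}$, so that it is a complex structure, which allows one to consider the 6-dimensional real vector space $W=T_X\mathbb{S}^6$ as a 3-dimensional complex vector space with $\mathbf{i}Y:=J(Y)$. Besides, $$\sigma\colon W\times W\to\mathbb{C},\qquad \sigma(Y,Z)=n(Y,Z)-\mathbf{i}\,n(J(Y),Z),$$ is a nondegenerate Hermitian form. If $H_X=\{g\in G_{\Omega_1}:g(X)=X\}$ denotes the isotropy group of $X$, the map $$H_X\to\mathrm{SU}(W,\sigma),\qquad g\mapsto g|_W,$$ is well defined and a Lie group isomorphism. Therefore, $$G_{\Omega_1}/\mathrm{SU}(3)\cong\mathbb{S}^6.$$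
   Context: Let $\{e_i\}_{i=1}^7$ be the canonical basis of $\mathbb{R}^7$, $e^{ijk}:=e_i^*\wedge e_j^*\wedge e_k^*$, and $\Omega_1=e^{147}+e^{257}+e^{367}+e^{123}-e^{156}+e^{246}-e^{345}$. Let $n$ be the positive definite norm (quadratic form) for which $\{e_i\}$ is orthonormal; the same symbol denotes its polar form, $n(Y)=n(Y,Y)$. The related cross product $\times$ on $\mathbb{R}^7$ is defined by $n(Y\times Z,U)=\Omega_1(Y,Z,U)$ for all $Y,Z,U$. The group $G_{\Omega_1}=\{f\in\mathrm{GL}_7(\mathbb{R}):\Omega_1(f(Y),f(Z),f(U))=\Omega_1(Y,Z,U)\ \forall\, Y,Z,U\}$ acts naturally on $\mathbb{R}^7$, preserving $n$. Hermitian forms are $\mathbb{C}$-linear in the first variable. $\mathrm{SU}(W,\sigma)$ is the group of $\mathbb{C}$-linear maps of $W$ preserving $\sigma$ with complex determinant $1$. *)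

(* Defs.v *)
From HB Require Import structures.
From mathcomp Require Import all_boot all_order all_algebra.
From mathcomp Require Export complex.
From mathcomp Require Import ring.
From mathcomp Require Import all_classical all_reals all_analysis.

Set Implicit Arguments.
Unset Strict Implicit.
Unset Printing Implicit Defensive.

Import Order.TTheory GRing.Theory Num.Theory.
Import numFieldNormedType.Exports passmx.

Local Open Scope ring_scope.
Local Open Scope complex_scope.
Local Open Scope classical_set_scope.

(* Finite-dimensional complex vector space attached to a real one with an
   endomorphism of square -1: (a + b i) v = a v + b J v. *)
Section ComplexStructure.
Variables (R : realType) (V : vectType R) (J : 'End(V)).

Definition cplx (hJ : forall v, J (J v) = - v) : Type := V.

Variable hJ : forall v, J (J v) = - v.

Definition cplx_scale (z : R[i]) (v : V) : V :=
  complex.Re z *: v + complex.Im z *: J v.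

Fact cplx_scaleA a b v :
  cplx_scale a (cplx_scale b v) = cplx_scale (a * b) v.
Proof.
have JD (x y : R) u w : J (x *: u + y *: w) = x *: J u + y *: J w.
  by rewrite linearD !linearZ.
rewrite /cplx_scale JD hJ; case: a b => [a a'] [b b'] /=.
rewrite !scalerDr !scalerN !scalerA scalerBl scalerDl.
by rewrite -!addrA; congr (_ + _); rewrite addrA addrC.
Qed.

Fact cplx_scale1 : left_id 1 cplx_scale.
Proof. by move=> v; rewrite /cplx_scale /= scale1r scale0r addr0. Qed.

Fact cplx_scaleDr : right_distributive cplx_scale +%R.
Proof.
move=> z u v; rewrite /cplx_scale [J _]linearD !scalerDr -!addrA.
by congr (_ + _); rewrite addrCA.
Qed.

Fact cplx_scaleDl v : {morph cplx_scale^~ v : a b / a + b}.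
Proof.
move=> [a a'] [b b']; rewrite /cplx_scale /= !scalerDl -!addrA.
by congr (_ + _); rewrite addrCA.
Qed.

Local Notation VJ := (cplx hJ).

HB.instance Definition _ := GRing.Zmodule.copy VJ V.

HB.instance Definition _ := GRing.Zmodule_isLmodule.Build R[i] VJ
  cplx_scaleA cplx_scale1 cplx_scaleDr cplx_scaleDl.

Lemma cplx_scaleE (z : R[i]) (v : VJ) :
  z *: v = complex.Re z *: (v : V) + complex.Im z *: J v.
Proof. by []. Qed.

Lemma cplx_iE (v : VJ) : 'i%C *: v = J v.
Proof. by rewrite cplx_scaleE /= scale0r add0r scale1r. Qed.

Let comb n (b : 'I_n -> VJ) (c : 'rV[R[i]]_n) : VJ := \sum_i c 0 i *: b i.

Let comb_linear n b : linear (@comb n b).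
Proof.
move=> a u v; rewrite /comb scaler_sumr -big_split; apply: eq_bigr => i _ /=.
by rewrite !mxE scalerDl scalerA.
Qed.

Let comb_le n (b : 'I_n -> VJ) : injective (comb b) -> (n <= dim V)%N.
Proof.
move=> b_inj; pose f (c : 'rV[R]_n) : V := \sum_i c 0 i *: (b i : V).
have f_lin : linear f.
  move=> a u v; rewrite /f scaler_sumr -big_split; apply: eq_bigr => i _ /=.
  by rewrite !mxE scalerDl scalerA.
pose fL : {linear 'rV[R]_n -> V} :=
  HB.pack f (GRing.isLinear.Build R _ _ _ f f_lin).
have f_inj : lker (linfun fL) == 0%VS.
  apply/lker0P => u v; rewrite !lfunE /= => fuv.
  suff /b_inj /rowP e : comb b (map_mx (fun x => x%:C) u) =
                        comb b (map_mx (fun x => x%:C) v).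
    by apply/rowP => i; have := e i; rewrite !mxE => -[].
  have combE w : comb b (map_mx (fun x => x%:C) w) = f w.
    rewrite /comb /f; apply: eq_bigr => i _.
    by rewrite cplx_scaleE mxE /= scale0r addr0.
  by rewrite !combE.
have := limg_dim_eq (f := linfun fL) (U := fullv).
rewrite (eqP f_inj) capv0 => /(_ erefl) e.
have := dimvS (subvf (linfun fL @: fullv)%VS).
by rewrite e !dimvf (_ : dim 'rV[R]_n = n) //; exact: mul1n.
Qed.

Fact cplx_basis :
  exists n (f : VJ -> 'rV[R[i]]_n), linear f /\ bijective f.
Proof.
pose P n := `[< exists b : 'I_n -> VJ, injective (comb b) >].
have P0 : exists n, P n.
  by exists 0%N; apply/asboolP; exists (fun=> 0) => u v _; rewrite !thinmx0.
have Pb n : P n -> (n <= dim V)%N by move=> /asboolP[b /comb_le].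
have [n /asboolP[b b_inj] nmax] := ex_maxnP P0 Pb.
have b_surj v : exists c, comb b c = v.
  apply: contrapT => vNb.
  suff /nmax : P n.+1 by rewrite ltnn.
  pose b' (i : 'I_n.+1) := if unlift ord0 i is Some j then b j else v.
  apply/asboolP; exists b'.
  have comb'E c : comb b' c = c 0 0 *: v + comb b (\row_j c 0 (lift ord0 j)).
    rewrite /comb big_ord_recl /b' unlift_none; congr (_ + _).
    by apply: eq_bigr => i _; rewrite liftK mxE.
  pose combL := HB.pack (comb b)
    (GRing.isLinear.Build R[i] _ _ _ (comb b) (comb_linear b))
    : {linear 'rV[R[i]]_n -> VJ}.
  have combB u w : comb b (u - w) = comb b u - comb b w.
    exact: (linearB combL).
  have combZ a w : comb b (a *: w) = a *: comb b w.
    exact: (linearZ_LR combL).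
  move=> c d; rewrite !comb'E => cd.
  have e0 : (c 0 0 - d 0 0) *: v = comb b (\row_j d 0 (lift ord0 j) -
                                           \row_j c 0 (lift ord0 j)).
    rewrite combB scalerBl; apply/eqP.
    by rewrite subr_eq addrAC eq_sym subr_eq addrC eq_sym cd addrC.
  have [cd0|cd0] := eqVneq (c 0 0 - d 0 0) 0; last first.
    exfalso; apply: vNb; exists ((c 0 0 - d 0 0)^-1 *:
      (\row_j d 0 (lift ord0 j) - \row_j c 0 (lift ord0 j))).
    by rewrite combZ -e0 scalerA mulVf ?scale1r.
  have cd00 : c 0 0 = d 0 0 by apply/eqP; rewrite -subr_eq0 cd0.
  move: cd; rewrite cd00 => /addrI/b_inj/rowP e.
  apply/rowP => i; case: (unliftP ord0 i) => [j ->|-> //].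
  by have := e j; rewrite !mxE.
have [f fK] := choice b_surj.
have Kf : cancel (comb b) f by move=> c; apply: b_inj; rewrite fK.
exists n, f; split; last by exists (comb b).
move=> a u v; apply: b_inj; rewrite fK.
by rewrite comb_linear !fK.
Qed.

Fact cplx_vector_axiom : Vector.axiom (projT1 (cid cplx_basis)) VJ.
Proof.
by have [f [f_lin f_bij]] := cid (projT2 (cid cplx_basis)); exists f.
Qed.

HB.instance Definition _ := Lmodule_hasFinDim.Build R[i] VJ cplx_vector_axiom.

End ComplexStructure.

(* Restriction of scalars from C to R. *)
Section Realification.
Variables (R : realType) (U : vectType R[i]).

Definition realified : Type := U.

HB.instance Definition _ := GRing.Zmodule.copy realified U.

Definition real_scale (a : R) (u : U) : U := a%:C *: u.

Fact real_scaleA a b u : real_scale a (real_scale b u) = real_scale (a * b) u.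
Proof. by rewrite /real_scale scalerA rmorphM. Qed.

Fact real_scale1 : left_id 1 real_scale.
Proof. by move=> u; rewrite /real_scale rmorph1 scale1r. Qed.

Fact real_scaleDr : right_distributive real_scale +%R.
Proof. by move=> a u v; rewrite /real_scale scalerDr. Qed.

Fact real_scaleDl u : {morph real_scale^~ u : a b / a + b}.
Proof. by move=> a b; rewrite /real_scale rmorphD scalerDl. Qed.

HB.instance Definition _ := GRing.Zmodule_isLmodule.Build R realified
  real_scaleA real_scale1 real_scaleDr real_scaleDl.

Fact realified_vector_axiom :
  Vector.axiom (\dim {:U} + \dim {:U}) realified.
Proof.
pose re (z : R[i]) := complex.Re z; pose im (z : R[i]) := complex.Im z.
pose e := vbasis {:U}; have eP : basis_of {:U} e := vbasisP _.
pose f (u : U) : 'rV[R]_(\dim {:U} + \dim {:U}) :=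
  row_mx (map_mx re (rVof e u)) (map_mx im (rVof e u)).
pose g (w : 'rV[R]_(\dim {:U} + \dim {:U})) : U :=
  vecof e (\row_j (lsubmx w 0 j +i* rsubmx w 0 j)).
exists f; last first.
  exists g => [u|w].
    rewrite /g /f row_mxKl row_mxKr -[RHS](rVofK eP); congr vecof.
    by apply/rowP => j; rewrite !mxE; case: (coord _ _ _).
  rewrite /g /f vecofK // -[RHS]hsubmxK; congr row_mx; apply/rowP => j;
  by rewrite !mxE.
move=> a u v; rewrite /f scale_row_mx add_row_mx.
have -> : rVof e (a *: (u : realified) + v : U) = a%:C *: rVof e u + rVof e v.
  by rewrite -linearP.
congr row_mx; apply/rowP => j; rewrite !mxE;
by case: (coord e j u) (coord e j v) => [x y] [x' y'];
  rewrite /re /im /= ?mul0r ?subr0 ?addr0.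
Qed.

HB.instance Definition _ :=
  Lmodule_hasFinDim.Build R realified realified_vector_axiom.

End Realification.

Definition lfun_det (F : fieldType) (U : vectType F) (f : 'End(U)) : F :=
  \det (mxof (vbasis {:U}) (vbasis {:U}) f).

Lemma lfun_detE (F : fieldType) (U : vectType F)
    (e : (\dim {:U}).-tuple U) (f : 'End(U)) :
  basis_of {:U} e -> lfun_det f = \det (mxof e e f).
Proof.
move=> eP; have bP := vbasisP {:U}; set b := vbasis _ in bP.
have ebbe : mxof e b \1%VF *m mxof b e \1%VF = 1%:M.
  rewrite -(mxof_comp e e bP) comp_lfun1l; apply/row_matrixP => i.
  by rewrite !rowE mul_mxof vecof_delta lfunE /= mulmx1 rVofE.
have fE : mxof e e f = mxof e b \1%VF *m mxof b b f *m mxof b e \1%VF.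
  by rewrite -(mxof_comp e b bP) -(mxof_comp e e bP) comp_lfun1l comp_lfun1r.
by rewrite fE !det_mulmx mulrAC -det_mulmx ebbe det1 mul1r.
Qed.

(* Smooth maps between subsets of finite-dimensional real vector spaces.
   Topology and differentiability are read in the coordinates of the basis
   vbasis; neither depends on this choice. *)
Section Smooth.
Variable R : realType.

(* C^k on an open set: C^0 is continuity, and f is C^(k+1) if it is
   differentiable with all its directional derivatives of class C^k. *)
Fixpoint class_C (k m n : nat) (O : set 'rV[R]_m) (f : 'rV[R]_m -> 'rV[R]_n) :=
  match k with
  | 0 => forall x, O x -> {for x, continuous f}
  | k'.+1 => (forall x, O x -> differentiable f x) /\
             (forall v, class_C k' O (fun x => 'D_v f x))
  end.

Definition chart (V : vectType R) : V -> 'rV[R]_(\dim {:V}) :=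
  rVof (vbasis {:V}).
Definition unchart (V : vectType R) : 'rV[R]_(\dim {:V}) -> V :=
  vecof (vbasis {:V}).

Definition vopen (V : vectType R) (O : set V) :=
  open (@unchart V @^-1` O).
Definition vclosed (V : vectType R) (A : set V) :=
  closed (@unchart V @^-1` A).

(* f is smooth on A if near every point of A it agrees on A with a C^oo map
   defined on an open subset of the ambient space. *)
Definition smooth_on (V U : vectType R) (A : set V) (f : V -> U) :=
  forall x, A x -> exists (O : set V) (F : V -> U),
    [/\ vopen O, O x,
        forall k, class_C k (@unchart V @^-1` O)
                    (@chart U \o F \o @unchart V)
      & forall y, A y -> O y -> f y = F y].

(* By Cartan's theorem, closed groups of invertible elements are embedded
   submanifolds of the ambient algebra, hence Lie groups. *)
Definition closed_group (V : vectType R) (mul : V -> V -> V) (one : V)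
    (A : set V) :=
  [/\ A one, forall a b, A a -> A b -> A (mul a b),
      forall a, A a -> exists b, [/\ A b, mul a b = one & mul b a = one]
    & vclosed A].

Definition lie_group_iso (V U : vectType R)
    (mulV : V -> V -> V) (oneV : V) (A : set V)
    (mulU : U -> U -> U) (oneU : U) (B : set U) (f : V -> U) :=
  [/\ closed_group mulV oneV A, closed_group mulU oneU B, set_bij A B f,
      forall a b, A a -> A b -> f (mulV a b) = mulU (f a) (f b)
    & smooth_on A f /\
      exists g, (forall a, A a -> g (f a) = a) /\ smooth_on B g].

(* The quotient G / H as a set of left cosets. It carries the quotient smooth
   structure: a map out of it is smooth when its composition with the
   projection is, and a map into it is smooth when it lifts locally to smooth
   maps into G. *)
Definition left_coset (V : vectType R) (mul : V -> V -> V) (H : set V) (g : V) :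
  set V := [set mul g h | h in H].

Definition quotient_diffeo (V U : vectType R) (mul : V -> V -> V)
    (one : V) (G H : set V) (S : set U) (Phi : set V -> U) :=
  [/\ [/\ closed_group mul one G, closed_group mul one H & H `<=` G],
      set_bij [set left_coset mul H g | g in G] S Phi,
      smooth_on G (Phi \o left_coset mul H)
    & forall y, S y -> exists (O : set U) (s : U -> V),
        [/\ vopen O, O y, smooth_on (S `&` O) s
          & forall z, S z -> O z -> G (s z) /\ Phi (left_coset mul H (s z)) = z]].

End Smooth.

Section SpecialUnitary.
Variable R : realType.

Definition SU (U : vectType R[i]) (s : U -> U -> R[i]) : set 'End(U) :=
  [set f : 'End(U) | (forall x y, s (f x) (f y) = s x y) /\ lfun_det f = 1].

Definition SU_mx (n : nat) : set 'M[R[i]]_n :=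
  [set A | A \is unitarymx /\ \det A = 1].

End SpecialUnitary.

Section SixSphere.
Variable R : realType.
Local Notation V7 := 'cV[R]_7.

(* Indices run from 1 to 7, and the wedge of three covectors is evaluated as a
   determinant, without the factor 1/3!. *)
Definition ewedge (i j k : nat) (Y Z U : V7) : R :=
  \det (\matrix_(a < 3, b < 3)
    [:: Y; Z; U]`_b (inord (nth 0%N [:: i; j; k] a).-1) 0).

Definition Omega1 (Y Z U : V7) : R :=
  ewedge 1 4 7 Y Z U + ewedge 2 5 7 Y Z U + ewedge 3 6 7 Y Z U
  + ewedge 1 2 3 Y Z U - ewedge 1 5 6 Y Z U + ewedge 2 4 6 Y Z U
  - ewedge 3 4 5 Y Z U.

Definition npolar (Y Z : V7) : R := \sum_i Y i 0 * Z i 0.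

Definition nform (Y : V7) : R := npolar Y Y.

(* The vector representing Omega1 Y Z with respect to the inner product: see
   npolar_cross. *)
Definition cross (Y Z : V7) : V7 := \col_i Omega1 Y Z (delta_mx i 0).

Fact ewedge_linear i j k Y Z : linear (ewedge i j k Y Z : V7 -> R^o).
Proof.
move=> a u v; pose M w : 'M[R]_3 := \matrix_(p, q)
  [:: Y; Z; w]`_q (inord (nth 0%N [:: i; j; k] p).-1) 0.
rewrite -[LHS]/(\det (M (a *: u + v))) -[RHS]/(a * \det (M u) + \det (M v)).
rewrite -!(det_tr (M _)) -[\det (M v)^T]mul1r.
apply: (determinant_multilinear (i0 := ord_max)).
- by apply/rowP => p; rewrite !mxE /= mul1r.
- apply/matrixP => q p; rewrite !mxE; case: q => -[|[|[]]] //= ?.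
- apply/matrixP => q p; rewrite !mxE; case: q => -[|[|[]]] //= ?.
Qed.

Fact Omega1_linear Y Z : linear (Omega1 Y Z : V7 -> R^o).
Proof.
move=> a u v; rewrite /Omega1 !ewedge_linear /GRing.scale /=.
by ring.
Qed.

Lemma npolar_cross Y Z U : npolar (cross Y Z) U = Omega1 Y Z U.
Proof.
pose OL : {linear V7 -> R^o} := HB.pack (Omega1 Y Z : V7 -> R^o)
  (GRing.isLinear.Build R _ _ _ _ (Omega1_linear Y Z)).
rewrite [U in RHS](_ : U = \sum_i U i 0 *: delta_mx i 0); last first.
  by rewrite [LHS]matrix_sum_delta; apply: eq_bigr => i _; rewrite big_ord1.
rewrite -[RHS]/(OL _) linear_sum; apply: eq_bigr => i _.
by rewrite linearZ /= mxE mulrC.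
Qed.

Definition G_Omega1 : set 'M[R]_7 :=
  [set g | g \in unitmx /\
    forall Y Z U, Omega1 (g *m Y) (g *m Z) (g *m U) = Omega1 Y Z U].

Definition S6 : set V7 := [set Y | nform Y = 1].

Variable X : V7.

Definition isotropy : set 'M[R]_7 := [set g | G_Omega1 g /\ g *m X = X].

Fact npolar_linear Z : linear (npolar Z : V7 -> R^o).
Proof.
move=> a u v; rewrite /npolar scaler_sumr -big_split; apply: eq_bigr => i _ /=.
by rewrite !mxE mulrDr mulrCA.
Qed.

HB.instance Definition _ Z :=
  GRing.isLinear.Build R V7 R^o _ (npolar Z) (npolar_linear Z).

Definition perp : {vspace V7} := lker (linfun (npolar X : V7 -> R^o)).

Lemma mem_perp Y : (Y \in perp) = (npolar X Y == 0).
Proof. by rewrite memv_ker lfunE. Qed.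

Definition TS6 := subvs_of perp.

Definition Jcross : 'End(TS6) :=
  linfun (fun Y : TS6 => vsproj perp (cross X (vsval Y))).

Definition sigma (Y Z : TS6) : R[i] :=
  npolar (vsval Y) (vsval Z) -i* npolar (vsval (Jcross Y)) (vsval Z).

Definition restriction (hJ : forall Y, Jcross (Jcross Y) = - Y)
    (g : 'M[R]_7) : 'End(cplx hJ) :=
  linfun (fun Y : cplx hJ =>
    (vsproj perp (g *m vsval (Y : TS6)) : cplx hJ)).

End SixSphere.

(* Main.v *)
(* A linear map g preserving Omega1 preserves the norm up to |det g|, because
   det (i_Y Omega1 + x x^T)^2 = n(Y)^4 for every x with n(x, Y) = 1; taking
   determinants once more gives |det g| = 1.  Hence g commutes with the cross
   product.  On W = X^perp the form Omega1 is the real part of a C-trilinear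
   alternating form, so a C-linear isometry f of W extended by X |-> X preserves
   Omega1 exactly when det f = 1.
   For a unit vector u, multiplication by exp(2 i pi / 3) on u^perp lies in
   SU(u^perp), so the rotation by 120 degrees about u preserves Omega1.  When
   n(p, z) > -1/2 a suitable u, smooth in z, rotates p to z: this gives the
   transitivity on S^6 and the smooth local sections of g |-> g X.
   All the maps involved are affine, except the sections, which are built from
   affine maps by products, inverses and square roots. *)

Require Import Defs.
From HB Require Import structures.
From mathcomp Require Import all_boot all_order all_algebra.
From mathcomp Require Import complex.
From mathcomp Require Import ring lra.
From mathcomp Require Import all_classical all_reals all_analysis.

Set Implicit Arguments.
Unset Strict Implicit.
Unset Printing Implicit Defensive.

Import Order.TTheory GRing.Theory Num.Theory.
Import numFieldNormedType.Exports passmx.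
Local Open Scope ring_scope.
Local Open Scope classical_set_scope.

(** * The cross product *)

(** Invariance of Omega1 displays no metric. For fixed Y it is a congruence between skew matrices,
    but these have odd size 7 and are singular, so their determinants carry no information; the
    rank-one term x x^T fills the kernel and makes the determinant remember n(Y). A cube root of
    unity w is chosen because the scalar w on a complex 3-space has determinant w^3 = 1, so an
    explicit element of the group is available at once. The rotation about u takes p to a vector z
    with n(p, z) = (3 n(u, p)^2 - 1)/2, a value in [-1/2, 1]: hence the bound -1/2, at which the
    square root giving n(u, p) stops being smooth. Two such rotations, through a vector orthogonal
    to both ends, join any two points. Smoothness on a subset asks for an extension to the ambient
    space, so every map defined only on a group is paired with a formula that is linear or affine on
    the whole matrix space. *)

Ltac gen_coords Y :=
  move: (Y (inord 0) 0) (Y (inord 1) 0) (Y (inord 2) 0) (Y (inord 3) 0)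
        (Y (inord 4) 0) (Y (inord 5) 0) (Y (inord 6) 0) => ? ? ? ? ? ? ?.

Section CrossProduct.
Variable R : realType.
Local Notation V7 := 'cV[R]_7.
Implicit Types (X Y Z U V : V7) (a b : R).

Lemma ord7_ind (P : 'I_7 -> Prop) :
  P (inord 0) -> P (inord 1) -> P (inord 2) -> P (inord 3) -> P (inord 4) ->
  P (inord 5) -> P (inord 6) -> forall i, P i.
Proof.
move=> P0 P1 P2 P3 P4 P5 P6 [i li].
have -> : Ordinal li = inord i by apply/val_inj; rewrite /= inordK.
by do 7 (case: i li => [//|i li]).
Qed.

Lemma sum_ord7 (F : 'I_7 -> R) :
  \sum_i F i = F (inord 0) + F (inord 1) + F (inord 2) + F (inord 3) +
               F (inord 4) + F (inord 5) + F (inord 6).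
Proof.
rewrite (eq_bigr (fun i : 'I_7 => F (inord i))) => [|i _]; last first.
  by rewrite inord_val.
by rewrite -(big_mkord xpredT (F \o inord)) !big_nat_recr //= big_geq //= add0r.
Qed.

Lemma ewedgeE i j k Y Z U :
  let c (v : V7) (m : nat) := v (inord m.-1) 0 in
  ewedge i j k Y Z U =
    c Y i * (c Z j * c U k - c Z k * c U j)
  - c Z i * (c Y j * c U k - c Y k * c U j)
  + c U i * (c Y j * c Z k - c Y k * c Z j).
Proof.
rewrite /ewedge (expand_det_row _ ord0) !big_ord_recl big_ord0 /cofactor.
rewrite !(expand_det_row _ ord0) !big_ord_recl !big_ord0 /cofactor !det_mx11.
rewrite !mxE /=; ring.
Qed.

Lemma npolarE Y Z :
  let c (v : V7) (m : nat) := v (inord m) 0 in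
  npolar Y Z = c Y 0 * c Z 0 + c Y 1 * c Z 1 + c Y 2 * c Z 2 + c Y 3 * c Z 3
             + c Y 4 * c Z 4 + c Y 5 * c Z 5 + c Y 6 * c Z 6.
Proof. by rewrite /npolar sum_ord7. Qed.

Lemma crossE Y Z m :
  let y m := Y (inord m) 0 in let z m := Z (inord m) 0 in
  let w i j := y i * z j - y j * z i in (m < 7)%N ->
  cross Y Z (inord m) 0 = [:: w 3 6 + w 1 2 - w 4 5; w 4 6 - w 0 2 + w 3 5;
    w 5 6 + w 0 1 - w 3 4; - w 0 6 - w 1 5 + w 2 4; - w 1 6 + w 0 5 - w 2 3;
    - w 2 6 - w 0 4 + w 1 3; w 0 3 + w 1 4 + w 2 5]`_m.
Proof.
do 7 (case: m => [|m] /=; first by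
  move=> _; rewrite !mxE /Omega1 !ewedgeE !mxE -!val_eqE /= !inordK //=;
  gen_coords Y; gen_coords Z; ring).
by [].
Qed.

Lemma crossDr Y Z U : cross Y (Z + U) = cross Y Z + cross Y U.
Proof.
apply/colP; elim/ord7_ind; rewrite [RHS]mxE !crossE //= ?mxE;
by gen_coords Y; gen_coords Z; gen_coords U; ring.
Qed.

Lemma crossZr a Y Z : cross Y (a *: Z) = a *: cross Y Z.
Proof.
apply/colP; elim/ord7_ind; rewrite [RHS]mxE !crossE //= ?mxE;
by gen_coords Y; gen_coords Z; ring.
Qed.

Lemma crossC Y Z : cross Y Z = - cross Z Y.
Proof.
apply/colP; elim/ord7_ind; rewrite [RHS]mxE !crossE //=;
by gen_coords Y; gen_coords Z; ring.
Qed.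

(** The quadratic identity behind the complex structure, checked in coordinates. With bilinearity
    and the symmetries of Omega1, it yields the later identities without coordinates. *)
Lemma cross_cross X Y :
  cross X (cross X Y) = npolar X Y *: X - npolar X X *: Y.
Proof.
rewrite !npolarE; apply/colP.
elim/ord7_ind; rewrite crossE //= !crossE //= !mxE;
by gen_coords X; gen_coords Y; ring.
Qed.

Lemma Omega1_rot X Y Z : Omega1 X Y Z = Omega1 Y Z X.
Proof. rewrite /Omega1 !ewedgeE; ring. Qed.

Lemma npolarC Y Z : npolar Y Z = npolar Z Y.
Proof. by apply: eq_bigr => i _; rewrite mulrC. Qed.

End CrossProduct.

Local Opaque cross Omega1.

(** * Coordinate-free identities of the cross product *)

Section CrossProduct.
Variable R : realType.
Local Notation V7 := 'cV[R]_7.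
Implicit Types (X Y Z U V : V7) (a b : R).

Lemma npolarDr Y Z U : npolar Y (Z + U) = npolar Y Z + npolar Y U.
Proof. exact: (linearD (npolar Y)). Qed.

Lemma npolarZr a Y Z : npolar Y (a *: Z) = a * npolar Y Z.
Proof. exact: (linearZ_LR (npolar Y)). Qed.

Lemma npolarDl Y Z U : npolar (Y + Z) U = npolar Y U + npolar Z U.
Proof. by rewrite !(npolarC _ U) npolarDr. Qed.

Lemma npolarZl a Y Z : npolar (a *: Y) Z = a * npolar Y Z.
Proof. by rewrite !(npolarC _ Z) npolarZr. Qed.

Lemma npolarNr Y Z : npolar Y (- Z) = - npolar Y Z.
Proof. exact: (linearN (npolar Y)). Qed.

Lemma npolarNl Y Z : npolar (- Y) Z = - npolar Y Z.
Proof. by rewrite !(npolarC _ Z) npolarNr. Qed.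

Lemma npolar0r Y : npolar Y 0 = 0.
Proof. exact: (linear0 (npolar Y)). Qed.

Lemma npolar0l Y : npolar 0 Y = 0.
Proof. by rewrite npolarC npolar0r. Qed.

Lemma npolar_mx Y Z : npolar Y Z = (Y^T *m Z) 0 0.
Proof. by rewrite mxE; apply: eq_bigr => i _; rewrite mxE. Qed.

Lemma npolar_delta Y i : npolar Y (delta_mx i 0) = Y i 0.
Proof.
rewrite /npolar (bigD1 i) //= mxE !eqxx mulr1 big1 ?addr0 // => j /negPf ji.
by rewrite mxE ji mulr0.
Qed.

Lemma npolar_ext Y Z : (forall U, npolar Y U = npolar Z U) -> Y = Z.
Proof. by move=> e; apply/colP => i; rewrite -!npolar_delta. Qed.

Lemma nform_ge0 Y : 0 <= nform Y.
Proof. by apply: sumr_ge0 => i _; rewrite -expr2 sqr_ge0. Qed.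

Lemma nform_eq0 Y : (nform Y == 0) = (Y == 0).
Proof.
apply/eqP/eqP => [/eqP|->]; last exact: npolar0r.
rewrite psumr_eq0 => [/allP Y0|i _]; last by rewrite -expr2 sqr_ge0.
apply/colP => i; have := Y0 i (mem_index_enum i).
by rewrite mulf_eq0 orbb mxE => /eqP.
Qed.

Lemma nform_gt0 Y : (0 < nform Y) = (Y != 0).
Proof. by rewrite lt_def nform_eq0 nform_ge0 andbT. Qed.

Lemma crossNr Y Z : cross Y (- Z) = - cross Y Z.
Proof. by rewrite -[- Z]scaleN1r crossZr scaleN1r. Qed.

Lemma crossNl Y Z : cross (- Y) Z = - cross Y Z.
Proof. by rewrite crossC crossNr -crossC. Qed.

Lemma crossDl Y Z U : cross (Y + Z) U = cross Y U + cross Z U.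
Proof. by rewrite crossC crossDr opprD -!(crossC _ U). Qed.

Lemma crossZl a Y Z : cross (a *: Y) Z = a *: cross Y Z.
Proof. by rewrite crossC crossZr -scalerN -crossC. Qed.

Lemma cross_same Y : cross Y Y = 0.
Proof.
by apply/colP => i; have /colP/(_ i) := crossC Y Y; rewrite !mxE; lra.
Qed.

Lemma npolar_crossC Y Z U : npolar (cross Y Z) U = npolar Y (cross Z U).
Proof. by rewrite npolar_cross [RHS]npolarC npolar_cross Omega1_rot. Qed.

Lemma npolar_cross_skew Y Z U : npolar (cross Y Z) U = - npolar Z (cross Y U).
Proof. by rewrite crossC npolarNl npolar_crossC. Qed.

Lemma npolar_crossl Y Z : npolar Y (cross Y Z) = 0.
Proof. by rewrite -npolar_crossC cross_same npolar0l. Qed.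

(** Polarization of [cross_cross] in its first argument. *)
Lemma cross_crossD X Y Z : cross X (cross Y Z) + cross Y (cross X Z) =
  npolar X Z *: Y + npolar Y Z *: X - (npolar X Y *+ 2) *: Z.
Proof.
have := cross_cross (X + Y) Z.
rewrite !crossDl (crossDr X) (crossDr Y) !npolarDl !npolarDr.
rewrite (cross_cross X) (cross_cross Y).
rewrite (npolarC Y X) => /colP e; apply/colP => i.
by have := e i; rewrite !mxE; lra.
Qed.

End CrossProduct.

(** Both block products in [e] equal the matrix with rows (1, u) and (-v, 1); comparing their
    determinants gives the formula. *)
Lemma det_add_rank1 (F : comNzRingType) n (u : 'cV[F]_n) (v : 'rV[F]_n) :
  \det (1%:M + u *m v) = 1 + (v *m u) 0 0.
Proof.
have e : block_mx (1%:M + u *m v) u 0 1%:M *m block_mx 1%:M 0 (- v) 1%:M =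
    block_mx 1%:M 0 (- v) 1%:M *m block_mx 1%:M u 0 (1%:M + v *m u).
  rewrite !mulmx_block !(mulmx1, mul1mx, mulmx0, mul0mx, addr0, add0r) mulmxN.
  by rewrite mulNmx addrK (addrC (- _)) addrK.
have := congr1 determinant e; rewrite !det_mulmx !det_ublock !det_lblock !det1.
by rewrite !mulr1 !mul1r det_mx11 !mxE => ->.
Qed.

(** * The metric is determined by Omega1 *)

Section Metric.
Variable R : realType.
Local Notation V7 := 'cV[R]_7.
Implicit Types (X Y Z U V : V7) (a b : R).

Definition cross_mx Y : 'M[R]_7 := \matrix_(i, j) cross Y (delta_mx j 0) i 0.

Lemma mul_cross_mx Y Z : cross_mx Y *m Z = cross Y Z.
Proof.
apply/colP => i; rewrite mxE -[RHS]npolar_delta npolar_cross_skew -npolarNr.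
apply: eq_bigr => j _; rewrite mxE -[cross _ _ i 0]npolar_delta.
by rewrite npolar_cross_skew npolarC npolar_delta mulrC [in RHS]mxE.
Qed.

Lemma npolar_mul (g : 'M[R]_7) Y Z : npolar (g *m Y) Z = npolar Y (g^T *m Z).
Proof. by rewrite !npolar_mx trmx_mul mulmxA. Qed.

Lemma mulmx_ext m n (A B : 'M[R]_(m, n)) :
  (forall v : 'cV_n, A *m v = B *m v) -> A = B.
Proof.
by move=> e; apply/trmx_inj/row_matrixP => i; rewrite -!tr_col !colE e.
Qed.

Lemma tr_cross_mx Y : (cross_mx Y)^T = - cross_mx Y.
Proof.
apply: mulmx_ext => Z; apply: npolar_ext => U.
rewrite npolar_mul trmxK mulNmx npolarNl !mul_cross_mx npolar_cross_skew.
by rewrite opprK.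
Qed.

Lemma outer_mulmx Y Z U : Y *m Z^T *m U = npolar Z U *: Y.
Proof.
by rewrite -mulmxA [Z^T *m U]mx11_scalar mul_mx_scalar npolar_mx.
Qed.

Lemma sqr_cross_mx Y :
  cross_mx Y *m cross_mx Y = Y *m Y^T - nform Y *: 1%:M.
Proof.
apply: mulmx_ext => Z; rewrite -mulmxA !mul_cross_mx cross_cross mulmxBl.
by rewrite outer_mulmx -scalemxAl mul1mx.
Qed.

(* The vectors [x] with [npolar x Y = 1] form one orbit of the transvections
   [1 + w Y^T], which fix [cross_mx Y] by congruence; hence the choice of [x]
   does not matter and [x = Y / n(Y)] may be assumed. *)
Lemma det_cross_mx_rank1 Y (x : V7) : npolar x Y = 1 ->
  \det (cross_mx Y + x *m x^T) ^+ 2 = nform Y ^+ 4.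
Proof.
move=> xY; set N := nform Y; set C := cross_mx Y.
have N0 : N != 0.
  rewrite nform_eq0; apply: contra_eq_neq xY => ->.
  by rewrite npolar0r eq_sym oner_neq0.
have CY : C *m Y = 0 by rewrite mul_cross_mx cross_same.
have YC : Y^T *m C = 0.
  by apply: trmx_inj; rewrite trmx_mul trmxK tr_cross_mx mulNmx CY oppr0 trmx0.
pose y := N^-1 *: Y; pose w := x - y.
have yY : npolar Y y = 1 by rewrite npolarZr mulVf.
pose T := 1%:M + w *m Y^T.
have detT : \det T = 1.
  rewrite det_add_rank1 -npolar_mx npolarDr npolarNr yY npolarC xY.
  by rewrite subrr addr0.
have Ty : T *m y = x.
  by rewrite mulmxDl mul1mx outer_mulmx yY scale1r addrC subrK.
have TC : T *m C *m T^T = C.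
  rewrite mulmxDl mul1mx -mulmxA YC mulmx0 addr0.
  rewrite linearD /= trmx1 trmx_mul trmxK.
  by rewrite mulmxDr mulmx1 mulmxA CY mul0mx addr0.
have -> : C + x *m x^T = T *m (C + y *m y^T) *m T^T.
  by rewrite mulmxDr mulmxDl TC -{1 2}Ty trmx_mul !mulmxA.
rewrite !det_mulmx det_tr detT mul1r mulr1.
(* The matrix M M^T is a rank-one perturbation of a scalar matrix, since C kills Y: it is N on the
   orthogonal of Y and N^-2 on Y, so its determinant is N^6 N^-2 = N^4. *)
have <- : \det ((C + y *m y^T) *m (C + y *m y^T)^T) =
          \det (C + y *m y^T) ^+ 2 by rewrite det_mulmx det_tr.
have -> : (C + y *m y^T) *m (C + y *m y^T)^T =
    N *: (1%:M + ((N ^- 4 - N^-1) *: Y) *m Y^T).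
  have yy : y *m y^T = N ^- 2 *: (Y *m Y^T).
    by rewrite /y linearZ /= -scalemxAl -scalemxAr scalerA -invfM.
  rewrite linearD /= tr_cross_mx trmx_mul trmxK yy.
  rewrite mulmxDl !mulmxDr mulmxN -/C sqr_cross_mx -/N.
  rewrite -!scalemxAl mulmxN -!scalemxAr -!mulmxA YC !mulmxA CY.
  rewrite mul0mx mulmx0 oppr0 !scaler0 addr0 add0r.
  rewrite -(mulmxA Y Y^T Y) [Y^T *m Y]mx11_scalar -npolar_mx -/(nform Y) -/N.
  rewrite mul_mx_scalar -!scalemxAl.
  apply/matrixP => i j; rewrite !mxE; by field.
rewrite detZ det_add_rank1 -scalemxAr mxE -npolar_mx -/(nform Y) -/N.
by field.
Qed.

Lemma G_Omega1_npolar (g : 'M[R]_7) : G_Omega1 g ->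
  forall Y Z, npolar (g *m Y) (g *m Z) = npolar Y Z.
Proof.
case=> gU gO; set d := `|\det g|.
have det0 : \det g != 0 by rewrite -unitfE -unitmxE.
have d0 : 0 < d by rewrite normr_gt0.
have gC Y : g^T *m cross_mx (g *m Y) *m g = cross_mx Y.
  apply: mulmx_ext => Z; apply: npolar_ext => U.
  rewrite -!mulmxA npolar_mul trmxK !mul_cross_mx !npolar_cross; exact: gO.
have dn Y : d * nform (g *m Y) = nform Y.
  have [->|Y0] := eqVneq Y 0; first by rewrite mulmx0 /nform npolar0r mulr0.
  have N0 : nform Y != 0 by rewrite nform_eq0.
  (* The vector x is chosen so that g^T x = y: the congruence [gC] then extends to the rank-one
     terms, and both sides are normalized as [det_cross_mx_rank1] asks. *)
  pose y := (nform Y)^-1 *: Y; pose x := (invmx g)^T *m y.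
  have yY : npolar y Y = 1 by rewrite npolarZl mulVf.
  have xY : npolar x (g *m Y) = 1 by rewrite npolar_mul trmxK mulKmx.
  have gx : g^T *m x = y by rewrite mulmxA -trmx_mul mulVmx // trmx1 mul1mx.
  clearbody x.
  have e : g^T *m (cross_mx (g *m Y) + x *m x^T) *m g = cross_mx Y + y *m y^T.
    by rewrite mulmxDr mulmxDl gC -gx trmx_mul trmxK !mulmxA.
  (* The squared determinants give det(g)^4 n(gY)^4 = n(Y)^4; both norms being nonnegative, fourth
     roots can be taken. *)
  have := det_cross_mx_rank1 yY.
  rewrite -e !det_mulmx det_tr !exprMn (det_cross_mx_rank1 xY) => {}e.
  apply/eqP; rewrite -(@eqrXn2 _ 4) ?mulr_ge0 ?nform_ge0 ?ltW //.
  by rewrite exprMn -e /d -normrX ger0_norm ?exprn_even_ge0 //; apply/eqP; ring.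
have dp Y Z : d * npolar (g *m Y) (g *m Z) = npolar Y Z.
  have := dn (Y + Z); rewrite mulmxDr /nform !(npolarDl, npolarDr).
  rewrite !mulrDr (dn Y) (dn Z) (npolarC Z) (npolarC (g *m Z)) -/(nform _).
  lra.
have gg : d *: (g^T *m g) = 1%:M.
  apply: mulmx_ext => Z; apply: npolar_ext => U.
  by rewrite -scalemxAl npolarZl -mulmxA npolar_mul trmxK mul1mx dp.
(* In size 7, [gg] gives d^7 det(g)^2 = 1, and det(g)^2 = d^2, whence d^9 = 1. *)
have d1 : d = 1.
  have := congr1 determinant gg; rewrite detZ det_mulmx det_tr det1 => e.
  apply/eqP; rewrite -(@pexpr_eq1 _ _ 9) ?ltW //.
  by rewrite (exprD _ 7 2) -[d ^+ 2]normrX ger0_norm ?sqr_ge0 // expr2 e.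
by move=> Y Z; rewrite -(dp Y Z) d1 mul1r.
Qed.

Lemma G_Omega1_cross (g : 'M[R]_7) : G_Omega1 g ->
  forall Y Z, cross (g *m Y) (g *m Z) = g *m cross Y Z.
Proof.
move=> gG Y Z; have [gU gO] := gG; apply: npolar_ext => U.
rewrite -[U](mulKVmx gU) npolar_cross gO (G_Omega1_npolar gG).
by rewrite npolar_cross.
Qed.

End Metric.

(** * Rotations in the stabilizer of Omega1 *)

Local Opaque npolar.

Section Isotropy.
Variable R : realType.
Local Notation V7 := 'cV[R]_7.
Implicit Types (X Y Z U V u : V7) (a b c : R) (g h : 'M[R]_7).

(** The trace of [sqr_cross_mx] is n(Y) - 7 n(Y), so a vanishing [cross_mx Y] forces n(Y) = 0. *)
Lemma Omega1_nondegenerate Y : (forall Z U, Omega1 Y Z U = 0) -> Y = 0.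
Proof.
move=> Y0; apply/eqP; rewrite -nform_eq0.
have C0 : cross_mx Y = 0.
  apply: mulmx_ext => Z; apply: npolar_ext => U.
  by rewrite mul_cross_mx npolar_cross Y0 mul0mx npolar0l.
have /(congr1 mxtrace) := sqr_cross_mx Y.
rewrite C0 mul0mx linear0 raddfB /= mxtraceZ mxtrace1 mxtrace_mulC.
by rewrite trace_mx11 -npolar_mx -/(nform Y) => e; apply/eqP; lra.
Qed.

(** A vector killed by g would lie in the kernel of Omega1. This reduces membership in the group to
    the invariance identity. *)
Lemma Omega1_unitmx g :
  (forall Y Z U, Omega1 (g *m Y) (g *m Z) (g *m U) = Omega1 Y Z U) ->
  g \in unitmx.
Proof.
move=> gO; rewrite -unitmx_tr -row_free_unit; apply/inj_row_free => v v0.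
apply: trmx_inj; rewrite trmx0; apply: Omega1_nondegenerate => Z U.
rewrite -gO; have -> : g *m v^T = 0.
  by rewrite -[g]trmxK -trmx_mul v0 trmx0.
by rewrite -npolar_cross -(scale0r (0 : V7)) crossZl scale0r npolar0l.
Qed.

Lemma G_Omega1P g : G_Omega1 g <->
  forall Y Z U, Omega1 (g *m Y) (g *m Z) (g *m U) = Omega1 Y Z U.
Proof. by split=> [[]|gO] //; split=> //; exact: Omega1_unitmx. Qed.

Lemma G_Omega1_1 : G_Omega1 (1%:M : 'M[R]_7).
Proof. by apply/G_Omega1P => Y Z U; rewrite !mul1mx. Qed.

Lemma G_Omega1_mul g h : G_Omega1 g -> G_Omega1 h -> G_Omega1 (g *m h).
Proof.
move=> [_ gO] [_ hO]; apply/G_Omega1P => Y Z U.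
by rewrite -!mulmxA gO hO.
Qed.

Lemma G_Omega1_inv g : G_Omega1 g -> G_Omega1 (invmx g).
Proof.
by move=> [gU gO]; apply/G_Omega1P => Y Z U; rewrite -gO !mulKVmx.
Qed.

(** Terms with X in two slots vanish; those with X in one slot pair its coefficient with the Kähler
    form [npolar (cross X _) _]. *)
Lemma Omega1_split X a b c Y Z U :
  Omega1 (a *: X + Y) (b *: X + Z) (c *: X + U) =
  Omega1 Y Z U + (a * npolar (cross X Z) U + b * npolar (cross X U) Y +
                  c * npolar (cross X Y) Z).
Proof.
have rot V1 V2 V3 : npolar (cross V1 V2) V3 = npolar (cross V2 V3) V1.
  by rewrite !npolar_cross Omega1_rot.
have XZX V : npolar (cross X V) X = 0 by rewrite npolarC npolar_crossl.
have YXX V : npolar (cross V X) X = 0 by rewrite crossC npolarNl XZX oppr0.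
rewrite -!npolar_cross crossDl crossZl !crossDr !crossZr.
rewrite cross_same scaler0 add0r.
rewrite !npolarDl !npolarZl !npolarDr !npolarZr XZX YXX.
rewrite (rot Y X U) -(rot X Y Z); ring.
Qed.

Lemma orth_decomp X : nform X = 1 -> forall Y,
  exists a Z, Y = a *: X + Z /\ npolar X Z = 0.
Proof.
move=> hX Y; exists (npolar X Y), (Y - npolar X Y *: X).
rewrite addrC subrK; split=> //.
by rewrite npolarDr npolarNr npolarZr -/(nform X) hX mulr1 subrr.
Qed.

(** By [Omega1_split], it suffices to control two pieces on the orthogonal of X: the Kähler form and
    the restriction of Omega1. *)
Lemma isotropyP X g : nform X = 1 -> g *m X = X ->
  (forall Y Z, npolar X Y = 0 -> npolar X Z = 0 ->
     npolar (cross X (g *m Y)) (g *m Z) = npolar (cross X Y) Z) ->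
  (forall Y Z U, npolar X Y = 0 -> npolar X Z = 0 -> npolar X U = 0 ->
     Omega1 (g *m Y) (g *m Z) (g *m U) = Omega1 Y Z U) ->
  isotropy X g.
Proof.
move=> hX gX gJ gO; split=> //; apply/G_Omega1P => Y Z U.
have [a [Y' [-> Y0]]] := orth_decomp hX Y.
have [b [Z' [-> Z0]]] := orth_decomp hX Z.
have [c [U' [-> U0]]] := orth_decomp hX U.
rewrite !mulmxDr -!scalemxAr gX (Omega1_split X a b c (g *m Y')).
rewrite (Omega1_split X a b c Y') (gO _ _ _ Y0 Z0 U0).
by rewrite (gJ _ _ Z0 U0) (gJ _ _ U0 Y0) (gJ _ _ Y0 Z0).
Qed.

(** * Compatibility of Omega1 with the complex structure on the orthogonal of X *)

Section Orthogonal.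
Variable X : V7.
Hypothesis hX : nform X = 1.

Lemma cross_cross_orth Y : npolar X Y = 0 -> cross X (cross X Y) = - Y.
Proof.
by move=> XY; rewrite cross_cross XY -/(nform X) hX scale0r scale1r sub0r.
Qed.

(** Pairing [cross_crossD] with U leaves only a multiple of X on the right, which U annihilates. *)
Lemma Omega1_cross_mid Y Z U : npolar X Y = 0 -> npolar X Z = 0 ->
  npolar X U = 0 -> Omega1 Y (cross X Z) U = - npolar (cross X (cross Y Z)) U.
Proof.
move=> XY XZ XU; have /(congr1 (npolar U)) := cross_crossD X Y Z.
rewrite XY XZ scale0r mul0rn scale0r subr0 add0r npolarDr npolarZr.
rewrite (npolarC U X) XU mulr0 ![npolar U _]npolarC -npolar_cross.
by move=> e; lra.
Qed.

(** The right side of [Omega1_cross_mid] is antisymmetric in Y and Z, so J slides from one slot to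
    the next. This is what makes [Phi] below C-trilinear. *)
Lemma Omega1_crossC Y Z U : npolar X Y = 0 -> npolar X Z = 0 ->
  npolar X U = 0 -> Omega1 (cross X Y) Z U = Omega1 Y (cross X Z) U.
Proof.
move=> XY XZ XU.
have -> : Omega1 (cross X Y) Z U = - Omega1 Z (cross X Y) U.
  by rewrite -!npolar_cross crossC npolarNl.
by rewrite !Omega1_cross_mid // [cross Z Y]crossC crossNr npolarNl opprK.
Qed.

Lemma Omega1_cross_right Y Z U : npolar X Y = 0 -> npolar X Z = 0 ->
  npolar X U = 0 -> Omega1 Y Z (cross X U) = Omega1 (cross X Y) Z U.
Proof.
move=> XY XZ XU; rewrite Omega1_rot -Omega1_crossC // Omega1_rot.
by rewrite Omega1_rot -Omega1_crossC.
Qed.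

End Orthogonal.

(* [rot120 u] fixes [u] and is multiplication by the cube root of unity
   [-1/2 + i sqrt 3 / 2] on the complex space orthogonal to [u]: it generates
   the centre of the isotropy group SU(3) of [u]. *)
Definition rot120 u : 'M[R]_7 :=
  - 2^-1 *: 1%:M + (3 / 2) *: (u *m u^T) + (Num.sqrt 3 / 2) *: cross_mx u.

Lemma rot120E u Y : rot120 u *m Y =
  - 2^-1 *: Y + (3 / 2 * npolar u Y) *: u + (Num.sqrt 3 / 2) *: cross u Y.
Proof.
by rewrite !mulmxDl -!scalemxAl mul1mx outer_mulmx mul_cross_mx scalerA.
Qed.

Lemma sqrt3K : Num.sqrt 3 * Num.sqrt 3 = 3 :> R.
Proof. by rewrite -expr2 sqr_sqrtr. Qed.

Lemma rot120_isotropy u : nform u = 1 -> isotropy u (rot120 u).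
Proof.
move=> hu; pose r : R := Num.sqrt 3; have rr : r * r = 3 := sqrt3K.
have rotu Y : npolar u Y = 0 ->
    rot120 u *m Y = - 2^-1 *: Y + (r / 2) *: cross u Y.
  by move=> uY; rewrite rot120E uY mulr0 scale0r addr0.
have Ou Y : npolar u (cross u Y) = 0 by exact: npolar_crossl.
apply: isotropyP => // [|Y Z Y0 Z0|Y Z U Y0 Z0 U0].
- rewrite rot120E -/(nform u) hu cross_same scaler0 addr0 -scalerDl.
  by rewrite -[RHS]scale1r; congr (_ *: _); lra.
- rewrite !rotu // crossDr !crossZr cross_cross_orth //.
  rewrite !npolarDl !npolarZl !npolarDr !npolarZr !npolarNl.
  have -> : npolar (cross u Y) (cross u Z) = npolar Y Z.
    by rewrite npolar_cross_skew cross_cross_orth // npolarNr opprK.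
  have -> : npolar Y (cross u Z) = - npolar (cross u Y) Z.
    by rewrite npolar_cross_skew opprK.
  (* The factor (1 + r^2)/4 is the squared modulus of -1/2 + i r/2. *)
  by transitivity ((1 + r * r) / 4 * npolar (cross u Y) Z);
    [field|rewrite rr; field].
- rewrite !rotu // -!npolar_cross !crossDl !crossDr !crossZl !crossZr.
  rewrite !npolarDl !npolarDr !npolarZl !npolarZr.
  rewrite !npolar_cross -!Omega1_crossC //.
  rewrite !Omega1_cross_right // -?Omega1_crossC // !cross_cross_orth //.
  rewrite crossNr.
  have ON V : Omega1 (- V) Z U = - Omega1 V Z U.
    by rewrite -!npolar_cross crossNl npolarNl.
  (* The two coefficients are the real and imaginary parts of the cube of -1/2 + i r/2, that is 1
     and 0 once r^2 = 3. *)
  rewrite !ON; transitivity ((3 * (r * r) - 1) / 8 * Omega1 Y Z U +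
    r * (3 - r * r) / 8 * Omega1 (cross u Y) Z U); first by field.
  by rewrite rr; field.
Qed.

(* The axis [u] of the rotation sending [p] to [z] is a combination of [p + z]
   and [cross p z]; its coefficients are forced by [nform u = 1] and
   [npolar u p = t], where [npolar p z = (3 t^2 - 1) / 2]. *)
Definition axis (p z : V7) : V7 := (1 + npolar p z)^-1 *:
  (Num.sqrt ((1 + 2 * npolar p z) / 3) *: (p + z) +
   (Num.sqrt 3 / 3) *: cross p z).

Section Axis.
Variables p z : V7.
Hypotheses (hp : nform p = 1) (hz : nform z = 1) (hpz : - 2^-1 < npolar p z).
Let m := npolar p z.
Let k := (1 + m)^-1.
Let t := Num.sqrt ((1 + 2 * m) / 3).
Let r : R := Num.sqrt 3.

Let kE : k * (1 + m) = 1.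
Proof. by rewrite mulVf // gt_eqF // /m; have := hpz; lra. Qed.

Let tE : t * t = (1 + 2 * m) / 3.
Proof. by rewrite -expr2 sqr_sqrtr // /m; have := hpz; lra. Qed.

Let cross_pz_p : npolar (cross p z) p = 0.
Proof. by rewrite npolarC npolar_crossl. Qed.

Let cross_pz_z : npolar (cross p z) z = 0.
Proof. by rewrite crossC npolarNl npolarC npolar_crossl oppr0. Qed.

Lemma nform_axis : nform (axis p z) = 1.
Proof.
have cc : npolar (cross p z) (cross p z) = 1 - m * m.
  rewrite npolar_cross_skew cross_cross npolarDr npolarNr !npolarZr.
  by rewrite -/(nform p) -/(nform z) hp hz (npolarC z p) -/m; ring.
have qq : npolar (p + z) (p + z) = 2 * (1 + m).
  rewrite npolarDl !npolarDr -/(nform p) -/(nform z) hp hz (npolarC z p) -/m.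
  by ring.
have cq : npolar (cross p z) (p + z) = 0.
  by rewrite npolarDr cross_pz_p cross_pz_z addr0.
rewrite /nform /axis -/m -/k -/t -/r npolarZl npolarZr npolarDl !npolarDr.
rewrite !npolarZl !npolarZr qq cc (npolarC (p + z)) cq.
(* [field] ignores the relations on k, t and r, so the goal is regrouped into the products they
   rewrite; the last factor then becomes 1 + m. *)
transitivity (k * (k * (1 + m)) * (2 * (t * t) + (r * r) * (1 - m) / 9));
  first by field.
rewrite kE tE sqrt3K mulr1; transitivity (k * (1 + m)); [by field|exact: kE].
Qed.

Lemma rot120_axis : rot120 (axis p z) *m p = z.
Proof.
have up : npolar (axis p z) p = t.
  rewrite npolarZl npolarDl !npolarZl npolarDl cross_pz_p mulr0 addr0.
  rewrite -/(nform p) hp (npolarC z p) -/m -/k -/t.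
  by rewrite mulrCA kE mulr1.
have uxp : cross (axis p z) p = k *: ((r / 3) *: (z - m *: p) - t *: cross p z).
  rewrite crossZl crossDl !crossZl crossDl cross_same add0r.
  rewrite (crossC z p) (crossC (cross p z) p) cross_cross.
  rewrite -/(nform p) hp scale1r opprB scalerN.
  by congr (_ *: _); rewrite addrC.
rewrite rot120E up uxp /axis -/m -/k -/t -/r; move: (cross p z) => w.
apply/colP => i; rewrite !mxE.
transitivity ((k * (3 / 2 * (t * t) - m * (r * r) / 6) - 2^-1) * p i 0 +
  k * (3 / 2 * (t * t) + r * r / 6) * z i 0); first by field.
rewrite tE sqrt3K; transitivity (((k * (1 + m)) / 2 - 2^-1) * p i 0 +
  (k * (1 + m)) * z i 0); first by field.
by rewrite kE; field.
Qed.

End Axis.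

Lemma nform_G g Y : G_Omega1 g -> nform (g *m Y) = nform Y.
Proof. by move=> gG; rewrite /nform G_Omega1_npolar. Qed.

Lemma rot120_axis_G p z : nform p = 1 -> nform z = 1 -> - 2^-1 < npolar p z ->
  G_Omega1 (rot120 (axis p z)) /\ rot120 (axis p z) *m p = z.
Proof.
move=> hp hz hpz; split; last exact: rot120_axis.
by have [] := rot120_isotropy (nform_axis hp hz hpz).
Qed.

(** Supplies the intermediate point of a two-step rotation: its inner product with either end is 0 >
    -1/2, even when the ends are antipodal. *)
Lemma unit_orth2 Y Z :
  exists p, [/\ nform p = 1, npolar p Y = 0 & npolar p Z = 0].
Proof.
pose A : 'M[R]_(7, 1 + 1) := row_mx Y Z.
have : kermx A != 0.
  rewrite -mxrank_eq0 mxrank_ker subn_eq0 -ltnNge.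
  exact: leq_ltn_trans (rank_leq_col A) _.
move=> /rowV0Pn[v vA v0]; pose q := v^T.
have q0 : 0 < nform q.
  by rewrite nform_gt0 -(inj_eq trmx_inj) trmx0 trmxK.
have := sub_kermxP vA; rewrite mul_mx_row -[0]row_mx0 => /eq_row_mx[vY vZ].
have qE W : npolar q W = (v *m W) 0 0 by rewrite npolar_mx trmxK.
exists ((Num.sqrt (nform q))^-1 *: q).
have sq : Num.sqrt (nform q) * Num.sqrt (nform q) = nform q.
  by rewrite -expr2 sqr_sqrtr // ltW.
split.
- rewrite /nform npolarZl npolarZr -/(nform q) mulrA -invfM sq.
  by rewrite mulVf // gt_eqF.
- by rewrite npolarZl qE vY mxE mulr0.
- by rewrite npolarZl qE vZ mxE mulr0.
Qed.

Lemma G_Omega1_transitive Y Z : nform Y = 1 -> nform Z = 1 ->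
  exists2 g, G_Omega1 g & g *m Y = Z.
Proof.
move=> hY hZ; have [p [hp pY pZ]] := unit_orth2 Y Z.
have [|G1 e1] := @rot120_axis_G Y p hY hp; first by rewrite npolarC pY; lra.
have [|G2 e2] := @rot120_axis_G p Z hp hZ; first by rewrite pZ; lra.
exists (rot120 (axis p Z) *m rot120 (axis Y p)); first exact: G_Omega1_mul.
by rewrite -mulmxA; exact: etrans (congr1 (mulmx _) e1) e2.
Qed.

End Isotropy.

(** * Smooth functions *)

Section SmoothFunctions.
Variable R : realType.

(* Up to equality on [O] this class is closed under differentiation, hence it
   consists of functions that are smooth on [O]. *)
Inductive smoothR (V : vectType R) (O : set V) : (V -> R) -> Prop :=
| smoothR_cst c : smoothR O (fun=> c)
| smoothR_lin (l : {linear V -> R^o}) : smoothR O l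
| smoothR_add f g : smoothR O f -> smoothR O g -> smoothR O (fun x => f x + g x)
| smoothR_mul f g : smoothR O f -> smoothR O g -> smoothR O (fun x => f x * g x)
| smoothR_inv f : (forall x, O x -> f x != 0) -> smoothR O f ->
    smoothR O (fun x => (f x)^-1)
| smoothR_sqrt f : (forall x, O x -> 0 < f x) -> smoothR O f ->
    smoothR O (fun x => Num.sqrt (f x)).

Lemma smoothR_comp (V U : vectType R) (h : {linear U -> V}) (O : set V) f :
  smoothR O f -> smoothR (h @^-1` O) (f \o h).
Proof.
elim=> [c|l|{}f g _ Hf _ Hg|{}f g _ Hf _ Hg|{}f f0 _ Hf|{}f f0 _ Hf].
- exact: smoothR_cst.
- exact: (smoothR_lin _ (l \o h)).
- exact: smoothR_add Hf Hg.
- exact: smoothR_mul Hf Hg.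
- by apply: smoothR_inv Hf => x; apply: f0.
- by apply: smoothR_sqrt Hf => x; apply: f0.
Qed.

Lemma linear_rV_continuous n (l : {linear 'rV[R]_n -> R^o}) : continuous l.
Proof.
have -> : (l : _ -> _) = \sum_j (fun x : 'rV[R]_n => x 0 j * l (delta_mx 0 j)).
  apply/funext => x; rewrite [in LHS](row_sum_delta x) linear_sum fct_sumE.
  by apply: eq_bigr => j _; rewrite linearZ.
move=> x; apply: differentiable_continuous; apply: differentiable_sum => j.
by apply: differentiableM => //; exact: differentiable_coord.
Qed.

Lemma smoothR_differentiable n (O : set 'rV[R]_n) f : smoothR O f ->
  forall x, O x -> differentiable f x.
Proof.
elim=> [c|l|{}f g _ Hf _ Hg|{}f g _ Hf _ Hg|{}f f0 _ Hf|{}f f0 _ Hf] x Ox.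
- exact: differentiable_cst.
- exact/linear_differentiable/linear_rV_continuous.
- exact: differentiableD (Hf _ Ox) (Hg _ Ox).
- exact: differentiableM (Hf _ Ox) (Hg _ Ox).
- exact: differentiableV (Hf _ Ox) (f0 _ Ox).
- apply: (@differentiable_comp _ _ _ _ f (Num.sqrt : R -> R)); first exact: Hf.
  by apply/derivable1_diffP; have [] := is_derive1_sqrt (f0 _ Ox).
Qed.

Lemma smoothR_derive n (O : set 'rV[R]_n) f : smoothR O f ->
  forall v, exists2 g, smoothR O g & forall x, O x -> 'D_v f x = g x.
Proof.
have dv h x v : smoothR O h -> O x -> derivable h x v.
  by move=> hS Ox; apply: diff_derivable; exact: smoothR_differentiable hS _ Ox.
move=> fS v; elim: fS => [c|l|{}f g fS [f' f'S fE] gS [g' g'S gE]|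
    {}f g fS [f' f'S fE] gS [g' g'S gE]|
    {}f f0 fS [f' f'S fE]|{}f f0 fS [f' f'S fE]].
- by exists (fun=> 0); [exact: smoothR_cst|move=> x _; rewrite derive_cst].
- exists (fun=> l v); first exact: smoothR_cst.
  move=> x _; rewrite deriveE; last first.
    exact/linear_differentiable/linear_rV_continuous.
  by rewrite diff_lin //; exact: linear_rV_continuous.
- exists (fun x => f' x + g' x); first exact: smoothR_add.
  move=> x Ox; rewrite -fE // -gE //.
  by apply: deriveD; exact: dv.
- exists (fun x => f x * g' x + g x * f' x).
    by apply: smoothR_add; exact: smoothR_mul.
  move=> x Ox; rewrite -fE // -gE //.
  by apply: deriveM; exact: dv.
- exists (fun x => (- 1 * ((f x)^-1 * (f x)^-1)) * f' x).
    apply: smoothR_mul => //; apply: smoothR_mul; first exact: smoothR_cst.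
    by apply: smoothR_mul; exact: smoothR_inv.
  move=> x Ox; rewrite /= -fE // mulN1r.
  rewrite [LHS](deriveV (f0 _ Ox)); last exact: dv.
  by rewrite -expr2 exprVn.
- exists (fun x => (2 * Num.sqrt (f x))^-1 * f' x).
    apply: smoothR_mul => //; apply: smoothR_inv.
      by move=> x Ox; rewrite mulf_neq0 ?gt_eqF // sqrtr_gt0 f0.
    by apply: smoothR_mul; [exact: smoothR_cst|exact: smoothR_sqrt].
  move=> x Ox; rewrite -fE //.
  have fD := smoothR_differentiable fS Ox.
  have [sD sE] := is_derive1_sqrt (f0 _ Ox).
  have sD' : differentiable (Num.sqrt : R -> R) (f x) by apply/derivable1_diffP.
  rewrite deriveE; last exact: differentiable_comp.
  rewrite -[fun x0 => _]/(Num.sqrt \o f) diff_comp //= diff1E // -deriveE //.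
  by rewrite derive1E sE [RHS]mulrC.
Qed.

(** The difference g - f vanishes near x, hence has differential 0 there; adding it to f preserves
    differentiability. *)
Lemma near_eq_differentiable (V W : normedModType R) (f g : V -> W) (x : V) :
  (\near x, f x = g x) -> differentiable f x -> differentiable g x.
Proof.
move=> fg fD; have -> : g = f + (g - f) by rewrite addrC subrK.
apply: differentiableD => //; set h := g - f.
have h0 : \near x, h x = 0.
  by apply: filterS fg => y e; rewrite -[LHS]/(g y - f y) e subrr.
have hx : h x = 0 := nbhs_singleton h0.
have e : h \o shift x = cst (h x) + (0 : V -> W) +o_ 0 id.
  apply/eqaddoP => e e0; near=> y.
  suff hy : h (y + x) = 0.
    rewrite [X in `|X|](_ : _ = h (y + x) - (h x + 0)) // hy hx addr0 subr0.
    by rewrite normr0; apply: mulr_ge0 => //; exact: ltW.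
  near: y; move: h0; rewrite (near_shift 0 x); apply: filterS => z.
  by rewrite /= subr0.
have c0 : continuous (0 : V -> W) by exact: cst_continuous.
apply/diff_locallyP; rewrite (diff_unique (df := \0) c0 e) //.
Unshelve. all: by end_near. Qed.

Lemma smoothR_row_differentiable m n (O : set 'rV[R]_m)
    (F : 'rV[R]_m -> 'rV[R]_n) f :
  open O -> (forall j, smoothR O (f j) /\ forall x, O x -> F x 0 j = f j x) ->
  forall x, O x -> differentiable F x.
Proof.
move=> oO fP x Ox; apply: (@near_eq_differentiable _ _
  (\sum_j (fun x => f j x *: delta_mx 0 j))).
  apply: filterS (open_nbhs_nbhs (conj oO Ox)) => y Oy.
  rewrite fct_sumE [RHS](row_sum_delta (F y)).
  by apply: eq_bigr => j _; rewrite (fP j).2.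
apply: differentiable_sum => j; apply: differentiableZl.
exact: smoothR_differentiable (fP j).1 _ Ox.
Qed.

(** Agreement of the coordinates with the class is asked on O only, because that is all the
    directional derivatives of F inherit; the induction on k needs this form. *)
Lemma class_C_smoothR m n (O : set 'rV[R]_m) (F : 'rV[R]_m -> 'rV[R]_n) :
  open O ->
  (forall j, exists f, smoothR O f /\ forall x, O x -> F x 0 j = f x) ->
  forall k, class_C k O F.
Proof.
move=> oO HF k; elim: k F HF => [|k IH] F /choice[f fP];
  have Fd := smoothR_row_differentiable oO fP.
  by move=> x /Fd; exact: differentiable_continuous.
split=> // v; apply: IH => j; have [g gS gE] := smoothR_derive (fP j).1 v.
exists g; split=> // x Ox; rewrite -gE //.
rewrite derive_mx; last exact/diff_derivable/Fd.
rewrite mxE; apply: near_eq_derive.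
by apply: filterS (open_nbhs_nbhs (conj oO Ox)) => y /(fP j).2.
Qed.

Section Charts.
Variables V U : vectType R.
Implicit Types (O A : set V) (F : V -> U).

Lemma class_C_chart O F : vopen O ->
  (forall l : {linear U -> R^o}, smoothR O (l \o F)) ->
  forall k, class_C k (@unchart R V @^-1` O) (@chart R U \o F \o @unchart R V).
Proof.
move=> oO FS; apply: class_C_smoothR => // j.
pose l : U -> R^o := fun u => rVof (vbasis {:U}) u 0 j.
have l_lin : linear l by move=> a u v; rewrite /l linearP !mxE.
pose lL : {linear U -> R^o} := HB.pack l (GRing.isLinear.Build R _ _ _ l l_lin).
exists ((lL \o F) \o @unchart R V); split=> //.
exact: (@smoothR_comp V 'rV[R]_(\dim {:V}) (vecof (vbasis {:V})) O _ (FS lL)).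
Qed.

Lemma vopenT : vopen [set: V].
Proof. exact: openT. Qed.

Lemma smooth_on_smoothR A F :
  (forall l : {linear U -> R^o}, smoothR setT (l \o F)) ->
  smooth_on A F.
Proof.
move=> FS x Ax; exists setT, F; split=> //; first exact: vopenT.
by apply: class_C_chart FS; exact: vopenT.
Qed.

Lemma smoothR_unchart_continuous h : smoothR [set: V] h ->
  continuous (h \o @unchart R V).
Proof.
move=> hS x; apply: differentiable_continuous.
exact: (smoothR_differentiable
  (@smoothR_comp V 'rV[R]_(\dim {:V}) (vecof (vbasis {:V})) setT h hS)).
Qed.

Lemma vopen_gt h : smoothR [set: V] h -> vopen [set x | 0 < h x].
Proof.
move=> hS.
have /continuousP/(_ [set y | 0 < y]) := smoothR_unchart_continuous hS.
by apply; exact: open_gt.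
Qed.

Lemma vclosed_eq I (h : I -> V -> R) (c : I -> R) :
  (forall i, smoothR [set: V] (h i)) -> vclosed [set x | forall i, h i x = c i].
Proof.
move=> hS; rewrite /vclosed.
rewrite (_ : _ @^-1` _ = \bigcap_i ((h i \o @unchart R V) @^-1` [set c i])).
  apply: closed_bigI => i _.
  have /continuous_closedP := smoothR_unchart_continuous (hS i); apply.
  exact: closed_eq.
by apply/seteqP; split=> [x xh i _|x xh i]; [exact: xh|exact: xh].
Qed.

End Charts.

End SmoothFunctions.

(** * The Hermitian space tangent to the sphere *)

Section Frame.
Variable R : realType.
Local Notation V7 := 'cV[R]_7.
Implicit Types (X Y Z U V u : V7) (a b c : R) (g h : 'M[R]_7).

Lemma ord3_ind (P : 'I_3 -> Prop) : P ord0 -> P 1 -> P ord_max -> forall i, P i.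
Proof.
move=> P0 P1 P2 [[|[|[|//]]] li]; [move: P0|move: P1|move: P2];
by congr P; apply/val_inj.
Qed.

(** The frame is written down at a basis vector, where J is explicit, and carried to X by an element
    of the group, which commutes with the cross product. *)
Lemma unitary_frame X : nform X = 1 -> exists b : 'I_3 -> V7,
  [/\ forall i, npolar X (b i) = 0,
      forall i j, npolar (b i) (b j) = (i == j)%:R,
      forall i j, npolar (cross X (b i)) (b j) = 0,
      forall Y, npolar X Y = 0 -> Y = \sum_i (npolar Y (b i) *: b i +
        npolar Y (cross X (b i)) *: cross X (b i))
    & Omega1 (cross X (b ord0)) (b 1) (b ord_max) != 0].
Proof.
(* With indices from 0 and J the product with [e 0], J sends [e 3], [e 1], [e 4] to [e 6], [e 2],
   [- e 5], so these three form a complex basis. The last claim then reads off the coefficient of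
   e^{257}. *)
pose e m : V7 := delta_mx (inord m) 0; pose s := [:: 3; 1; 4]%N.
have ne m n : (m < 7)%N -> (n < 7)%N -> npolar (e m) (e n) = (m == n)%:R.
  by move=> lm ln; rewrite npolar_delta mxE -val_eqE /= !inordK // andbT eq_sym.
have eE m n : (m < 7)%N -> (n < 7)%N -> e m (inord n) 0 = (m == n)%:R.
  by move=> lm ln; rewrite mxE -val_eqE /= !inordK // andbT eq_sym.
have simp := (mul0r, mulr0, mul1r, mulr1, subr0, sub0r, add0r, addr0, oppr0).
have h0 : nform (e 0) = 1 by rewrite /nform ne.
have J3 : cross (e 0) (e 3) = e 6.
  by apply/colP; elim/ord7_ind; rewrite crossE // !eE //= ?simp.
have J1 : cross (e 0) (e 1) = e 2.
  by apply/colP; elim/ord7_ind; rewrite crossE // !eE //= ?simp.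
have J4 : cross (e 0) (e 4) = - e 5.
  by apply/colP; elim/ord7_ind; rewrite crossE // [RHS]mxE !eE //= ?simp.
move=> hX; have [g gG gX] := G_Omega1_transitive h0 hX.
have gn := G_Omega1_npolar gG.
pose b0 (i : 'I_3) := e (nth 0 s i); exists (fun i => g *m b0 i).
have ls (i : 'I_3) : (nth 0 s i < 7)%N by case: i => -[|[|[|]]].
have gJ i : cross X (g *m b0 i) = g *m cross (e 0) (b0 i).
  by rewrite -gX (G_Omega1_cross gG).
split.
- by move=> i; rewrite -gX gn ne //; case: i => -[|[|[|]]].
- move=> i j; rewrite gn ne // -val_eqE.
  by case: i j => -[|[|[|]]] // ? [] [|[|[|]]].
- move=> i j; rewrite gJ gn.
  elim/ord3_ind: i.
  + by rewrite J3 ne //; case: j => -[|[|[|]]].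
  + by rewrite J1 ne //; case: j => -[|[|[|]]].
  + have j5 : (5 == nth 0 s j)%N = false by case: j => -[|[|[|]]].
    by rewrite J4 npolarNl ne // j5 oppr0.
- move=> Y XY; have [Z YZ] : exists Z, Y = g *m Z.
    by exists (invmx g *m Y); rewrite mulKVmx //; case: gG.
  rewrite {Y}YZ in XY *; have Z0 : npolar (e 0) Z = 0 by rewrite -gn gX.
  rewrite !big_ord_recl big_ord0 !gJ !gn.
  rewrite !scalemxAr -!mulmxDr addr0 -!mulmxDr; congr (_ *m _).
  have -> : b0 (lift ord0 ord0) = e 1 by [].
  have -> : b0 (lift ord0 (lift ord0 ord0)) = e 4 by [].
  have -> : b0 ord0 = e 3 by [].
  rewrite J3 J1 J4 npolarNr scaleNr scalerN opprK !npolar_delta.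
  rewrite npolarC npolar_delta in Z0.
  by apply/colP; elim/ord7_ind; rewrite !mxE -!val_eqE /= !inordK //= ?simp //.
- rewrite gJ (_ : b0 ord0 = e 3) // J3 gG.2 -npolar_cross.
  rewrite npolarC -[b0 ord_max]/(e 4) -[b0 1]/(e 1) npolarC.
  rewrite npolar_delta crossE //.
  by rewrite /= !eE //= ?simp oner_neq0.
Qed.

End Frame.

Lemma mul_matrix_lin (F : comNzRingType) m n
    (h : {linear 'cV[F]_n -> 'cV[F]_m}) v :
  (\matrix_(i, j) h (delta_mx j 0) i 0) *m v = h v.
Proof.
have {2}-> : v = \sum_j v j 0 *: delta_mx j 0.
  by rewrite {1}[v]matrix_sum_delta; apply: eq_bigr => j _; rewrite big_ord1.
rewrite linear_sum; apply/colP => i; rewrite mxE summxE.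
by apply: eq_bigr => j _; rewrite linearZ !mxE mulrC.
Qed.

Lemma det_mx33 (F : comNzRingType) (A : 'M[F]_3) : \det A =
    A ord0 ord0 * (A 1 1 * A ord_max ord_max - A 1 ord_max * A ord_max 1)
  - A ord0 1 * (A 1 ord0 * A ord_max ord_max - A 1 ord_max * A ord_max ord0)
  + A ord0 ord_max * (A 1 ord0 * A ord_max 1 - A 1 1 * A ord_max ord0).
Proof.
pose a m n := A (inord m) (inord n).
have aE i j : A i j = a i j by rewrite /a !inord_val.
rewrite (expand_det_row _ ord0) !big_ord_recl big_ord0 /cofactor.
rewrite !(expand_det_row _ ord0) !big_ord_recl !big_ord0 /cofactor !det_mx11.
by rewrite !mxE !aE /=; ring.
Qed.

Lemma lfun_det_basis (F : fieldType) (U : vectType F) n (e : n.-tuple U)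
    (f : 'End(U)) : basis_of {:U} e ->
  lfun_det f = \det (\matrix_(i, j) coord e j (f e`_i)).
Proof.
move=> eP; have d := size_basis eP; case: _ / d in e eP *.
rewrite (lfun_detE f eP); congr (\det _); apply/matrixP => i j.
by rewrite !mxE /= vecof_delta.
Qed.

Section TangentSpace.
Local Open Scope complex_scope.
Variable R : realType.
Local Notation V7 := 'cV[R]_7.
Variable X : V7.
Hypothesis hX : nform X = 1.

(** [linfun] represents a function only if it is linear, so linearity is packed first; the
    projection then does nothing, as the product is orthogonal to X. *)
Lemma vsval_Jcross (Y : TS6 X) : vsval (Jcross X Y) = cross X (vsval Y).
Proof.
pose f (Y : TS6 X) : TS6 X := vsproj (perp X) (cross X (vsval Y)).
have f_lin : linear f.
  by move=> a u v; rewrite /f linearP /= crossDr crossZr linearP.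
pose fL : {linear TS6 X -> TS6 X} := HB.pack f
  (GRing.isLinear.Build R _ _ _ f f_lin).
rewrite -[Jcross X]/(linfun fL) lfunE /= /f vsprojK // mem_perp.
by rewrite npolar_crossl.
Qed.

Lemma npolar_vsval (Y : TS6 X) : npolar X (vsval Y) = 0.
Proof. by apply/eqP; rewrite -mem_perp subvsP. Qed.

Lemma Jcross_Jcross (Y : TS6 X) : Jcross X (Jcross X Y) = - Y.
Proof.
by apply: val_inj; rewrite /= !vsval_Jcross cross_cross_orth ?npolar_vsval.
Qed.

Lemma dim_perp : \dim (perp X) = 6%N.
Proof.
have := limg_ker_dim (linfun (npolar X : V7 -> R^o)) fullv.
rewrite capfv -/(perp X) dimvf /dim /= => e.
have d1 : \dim (limg (linfun (npolar X : V7 -> R^o))) = 1%N.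
  apply/eqP; rewrite eqn_leq (leq_trans (dimvS (subvf _))) ?dimvf //=.
  rewrite lt0n dimv_eq0.
  apply/eqP => /(congr1 (fun U : {vspace R^o} => 1 \in U)).
  rewrite memv0 oner_eq0 => /negP; apply; apply/memv_imgP.
  by exists X; rewrite ?memvf // lfunE /= -/(nform X) hX.
by move: e; rewrite d1 addn1 muln1 => -[].
Qed.


Variable hJ : forall Y : TS6 X, Jcross X (Jcross X Y) = - Y.
Local Notation Wc := (cplx hJ).
Implicit Types (Y Z : Wc) (v w : V7) (z : R[i]).

Definition val7 (Y : Wc) : V7 := vsval (Y : TS6 X).
(** The component along X is removed first, so that this is the orthogonal projection, with an
    explicit formula on all of R^7. *)
Definition inj7 (v : V7) : Wc := vsproj (perp X) (v - npolar X v *: X).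

Lemma val7D Y Z : val7 (Y + Z) = val7 Y + val7 Z.
Proof. exact: (linearD vsval). Qed.

Lemma val7Z z Y : val7 (z *: Y) =
  complex.Re z *: val7 Y + complex.Im z *: cross X (val7 Y).
Proof. by rewrite cplx_scaleE /val7 linearD !linearZ /= vsval_Jcross. Qed.

Lemma val7_inj : injective val7.
Proof. exact: val_inj. Qed.

Lemma npolar_val7 Y : npolar X (val7 Y) = 0.
Proof. exact: npolar_vsval. Qed.

Lemma inj7K v : val7 (inj7 v) = v - npolar X v *: X.
Proof.
rewrite /val7 /inj7 vsprojK // mem_perp npolarDr npolarNr npolarZr -/(nform X).
by rewrite hX mulr1 subrr.
Qed.

Lemma val7K Y : inj7 (val7 Y) = Y.
Proof. by apply: val7_inj; rewrite inj7K npolar_val7 scale0r subr0. Qed.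

Lemma inj7P a v w : inj7 (a *: v + w) = a%:C *: inj7 v + inj7 w.
Proof.
apply: val7_inj; rewrite val7D val7Z !inj7K /= scale0r addr0.
rewrite npolarDr npolarZr scalerDl opprD scalerBr scalerA.
by rewrite !addrA; congr (_ - _); rewrite addrAC.
Qed.

Lemma sigmaE Y Z : sigma Y Z =
  npolar (val7 Y) (val7 Z) -i* npolar (cross X (val7 Y)) (val7 Z).
Proof. by rewrite /sigma vsval_Jcross. Qed.

Lemma sigma_linear Z : linear ((@sigma R X)^~ Z : Wc -> R[i]^o).
Proof.
move=> [a b] U V; rewrite !sigmaE val7D val7Z.
rewrite crossDr !crossDr !crossZr cross_cross_orth ?npolar_val7 //.
rewrite !npolarDl !npolarZl npolarNl.
by apply/eqP; rewrite eq_complex /=; apply/andP; split; apply/eqP; ring.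
Qed.

Lemma sigmaC Y Z : sigma Y Z = Num.conj (sigma Z Y).
Proof.
rewrite -[RHS]/(conjc _).
rewrite !sigmaE [npolar (cross X (val7 Z)) _]npolar_cross_skew.
rewrite (npolarC (val7 Z)) [npolar (val7 Z) _]npolarC.
by apply/eqP; rewrite eq_complex /= opprK !eqxx.
Qed.

Lemma hermitian_sigma :
  exists s : {hermitian_sym (Wc : vectType R[i]) for Num.conj},
  (forall Y Z, s Y Z = sigma Y Z) /\ nondegenerate s.
Proof.
pose f : Wc -> Wc -> R[i] := @sigma R X.
have fl Z : GRing.linear_for *%R (f^~ Z) := sigma_linear Z.
have fr Y : GRing.linear_for (Num.conj \; *%R) (f Y).
  move=> z U V; rewrite /f [LHS]sigmaC [X in Num.conj X](fl Y z U V).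
  by rewrite rmorphD rmorphM /= -!sigmaC.
have fC Y Z : f Y Z = (-1) ^+ false * Num.conj (f Z Y).
  by rewrite expr0 mul1r; exact: sigmaC.
pose s : {hermitian_sym (Wc : vectType R[i]) for Num.conj} := HB.pack f
  (bilinear_isBilinear.Build _ _ _ _ _ _ f (fl, fr))
  (isHermitianSesquilinear.Build _ _ _ _ f fC).
(* A vector Y of the radical satisfies sigma(Y, Y) = 0, whose real part is n(Y). *)
exists s; split=> //; rewrite /nondegenerate -subv0; apply/subvP => Y.
move=> /mem_orthovP/(_ Y (memvf _)) /eqP.
rewrite -[s Y Y]/(sigma Y Y) sigmaE eq_complex /= => /andP[+ _].
rewrite -/(nform _) nform_eq0 => /eqP Y0.
have -> : Y = 0 :> Wc by apply: val7_inj; rewrite Y0 [RHS](linear0 vsval).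
exact: mem0v.
Qed.

(** * Complex coordinates, determinants and the extension to R^7 *)

Section Coordinates.
Variable b : 'I_3 -> V7.
Hypothesis b_perp : forall i, npolar X (b i) = 0.
Hypothesis b_norm : forall i j, npolar (b i) (b j) = (i == j)%:R.
Hypothesis b_J : forall i j, npolar (cross X (b i)) (b j) = 0.
Hypothesis b_total : forall v, npolar X v = 0 ->
  v = \sum_i (npolar v (b i) *: b i +
              npolar v (cross X (b i)) *: cross X (b i)).
Hypothesis b_vol : Omega1 (cross X (b ord0)) (b 1) (b ord_max) != 0.

Definition frame (i : 'I_3) : Wc := inj7 (b i).
Definition uncoords (c : 'cV[R[i]]_3) : Wc := \sum_i c i 0 *: frame i.
Definition coords (Y : Wc) : 'cV[R[i]]_3 := \col_i sigma Y (frame i).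

Lemma val7_frame i : val7 (frame i) = b i.
Proof. by rewrite inj7K b_perp scale0r subr0. Qed.

Lemma uncoords_linear : linear uncoords.
Proof.
move=> z c d; rewrite /uncoords scaler_sumr -big_split.
apply: eq_bigr => i _ /=.
by rewrite !mxE scalerDl scalerA.
Qed.

Lemma coords_linear : linear coords.
Proof. by move=> z Y Z; apply/colP => i; rewrite !mxE sigma_linear. Qed.

Lemma val7_sum n (F : 'I_n -> Wc) : val7 (\sum_i F i) = \sum_i val7 (F i).
Proof. exact: (linear_sum vsval). Qed.

(** The real and imaginary parts of [sigma Y (frame i)] are n(Y, b i) and n(Y, J (b i)), the
    coefficients in [b_total]. *)
Lemma coordsK : cancel coords uncoords.
Proof.
move=> Y; apply: val7_inj; rewrite [RHS]b_total ?npolar_val7 // val7_sum.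
apply: eq_bigr => i _; rewrite val7Z mxE sigmaE val7_frame /=.
by rewrite npolar_cross_skew opprK.
Qed.

Lemma sigma_frame i j : sigma (frame i) (frame j) = (i == j)%:R.
Proof.
by rewrite sigmaE !val7_frame b_norm b_J oppr0 /=; case: (i == j).
Qed.

Lemma uncoordsK : cancel uncoords coords.
Proof.
move=> c; apply/colP => j; rewrite mxE.
have -> : sigma (uncoords c) (frame j) =
    \sum_i c i 0 * sigma (frame i) (frame j).
  pose L : {linear Wc -> R[i]^o} := HB.pack
    (fun Y : Wc => sigma Y (frame j) : R[i]^o)
    (GRing.isLinear.Build _ _ _ _ _ (sigma_linear (frame j))).
  rewrite -[LHS]/(L (uncoords c)) linear_sum; apply: eq_bigr => i _.
  by rewrite linearZ.
rewrite (bigD1 j) //= sigma_frame eqxx mulr1 big1 ?addr0 // => i /negPf ij.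
by rewrite sigma_frame ij mulr0.
Qed.

Lemma sigma_coords Y Z :
  sigma Y Z = ((coords Y)^T *m map_mx Num.conj (coords Z)) 0 0.
Proof.
rewrite -{1}[Y]coordsK mxE.
pose L : {linear Wc -> R[i]^o} := HB.pack (fun Y : Wc => sigma Y Z : R[i]^o)
  (GRing.isLinear.Build _ _ _ _ _ (sigma_linear Z)).
rewrite -[LHS]/(L (uncoords (coords Y))) linear_sum; apply: eq_bigr => i _.
by rewrite linearZ [L _]/= sigmaC !mxE.
Qed.

Lemma uncoords_delta i : uncoords (delta_mx i 0) = frame i.
Proof.
rewrite /uncoords (bigD1 i) //= mxE !eqxx scale1r big1 ?addr0 // => j /negPf ji.
by rewrite mxE ji scale0r.
Qed.

Lemma nth_frame (i : 'I_3) : [tuple frame i | i < 3]`_i = frame i.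
Proof. by rewrite -tnth_nth tnth_mktuple. Qed.

Lemma frame_basis : basis_of {:Wc} [tuple frame i | i < 3].
Proof.
apply/andP; split.
  rewrite eqEsubv subvf; apply/subvP => Y _; rewrite -[Y]coordsK.
  apply: memv_suml => i _; apply/memvZ/memv_span.
  by rewrite -nth_frame mem_nth // size_tuple.
apply/freeP => k k0 i; have : uncoords (\col_i k i) = 0.
  by rewrite -k0; apply: eq_bigr => j _; rewrite mxE nth_frame.
move=> /(congr1 coords) /colP/(_ i); rewrite uncoordsK !mxE => ->.
pose L : {linear Wc -> 'cV[R[i]]_3} := HB.pack (coords : Wc -> 'cV[R[i]]_3)
  (GRing.isLinear.Build _ _ _ _ _ coords_linear).
by have /colP/(_ i) := linear0 L; rewrite !mxE.
Qed.

Lemma coord_frame Y j : coord [tuple frame i | i < 3] j Y = coords Y j 0.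
Proof.
rewrite {2}(coord_basis frame_basis (memvf Y)).
set e := [tuple frame i | i < 3].
have -> : \sum_(i < 3) coord e i Y *: e`_i = uncoords (\col_i coord e i Y).
  by apply: eq_bigr => i _; rewrite mxE nth_frame.
by rewrite uncoordsK mxE.
Qed.

Definition lfun_mx (f : 'End(Wc)) : 'M[R[i]]_3 :=
  \matrix_(i, j) coords (f (frame j)) i 0.
Definition mx_endo (A : 'M[R[i]]_3) : 'End(Wc) :=
  linfun (fun Y : Wc => uncoords (A *m coords Y)).

Lemma lfun_det_mx f : lfun_det f = \det (lfun_mx f).
Proof.
rewrite (lfun_det_basis f frame_basis) -det_tr; congr (\det _).
by apply/matrixP => i j; rewrite !mxE coord_frame mxE -tnth_nth tnth_mktuple.
Qed.

Lemma mx_endoE A Y : mx_endo A Y = uncoords (A *m coords Y).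
Proof.
pose L : {linear Wc -> Wc} := HB.pack
  (fun Y : Wc => uncoords (A *m coords Y) : Wc)
  (GRing.isLinear.Build R[i] Wc Wc _ (fun Y : Wc => uncoords (A *m coords Y))
    (fun z Y Z => etrans
      (congr1 (fun c => uncoords (A *m c)) (coords_linear z Y Z))
      (etrans (congr1 uncoords (etrans (mulmxDr _ _ _) (congr1 (fun c => c + _)
        (esym (scalemxAr _ _ _))))) (uncoords_linear _ _ _)))).
by rewrite -[mx_endo A]/(linfun L) lfunE.
Qed.

Lemma lfun_mx_mul (f : 'End(Wc)) Y : coords (f Y) = lfun_mx f *m coords Y.
Proof.
rewrite -{1}[Y]coordsK /uncoords linear_sum.
pose L : {linear Wc -> 'cV[R[i]]_3} := HB.pack (coords : Wc -> 'cV[R[i]]_3)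
  (GRing.isLinear.Build _ _ _ _ _ coords_linear).
rewrite -[coords]/(L : _ -> _) linear_sum; apply/colP => i.
rewrite summxE [RHS]mxE.
by apply: eq_bigr => j _; rewrite !linearZ [LHS]mxE mulrC [in RHS]mxE.
Qed.

Lemma mx_endoK : cancel mx_endo lfun_mx.
Proof.
move=> A; apply/matrixP => i j; rewrite mxE mx_endoE uncoordsK.
by rewrite -(uncoords_delta j) uncoordsK -colE mxE.
Qed.

Lemma lfun_mxK : cancel lfun_mx mx_endo.
Proof.
by move=> f; apply/lfunP => Y; rewrite mx_endoE -lfun_mx_mul coordsK.
Qed.

Lemma SU_mx_endo A : SU_mx A <-> SU (U := Wc) (@sigma R X) (mx_endo A).
Proof.
rewrite /SU_mx /SU /= lfun_det_mx mx_endoK.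
have sE Y Z : sigma (mx_endo A Y) (mx_endo A Z) =
    ((coords Y)^T *m (A^T *m map_mx Num.conj A) *m
     map_mx Num.conj (coords Z)) 0 0.
  by rewrite sigma_coords !mx_endoE !uncoordsK trmx_mul map_mxM !mulmxA.
(* [unitarymx] bounds A times its adjoint on the right, while preservation of sigma yields the
   transpose of the product in the other order. *)
have uE : A \is unitarymx <-> A^T *m map_mx Num.conj A = 1%:M.
  have tE : (A^T *m map_mx Num.conj A)^T = map_mx Num.conj A^T *m A.
    by rewrite trmx_mul trmxK map_trmx.
  split=> [/unitarymxP/mulmx1C e|e].
    by apply: trmx_inj; rewrite tE e trmx1.
  by apply/unitarymxP/mulmx1C; rewrite -tE e trmx1.
have coords_frame i : coords (frame i) = delta_mx i 0.
  by rewrite -uncoords_delta uncoordsK.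
split=> -[sA detA]; split=> //.
  by move=> Y Z; rewrite sE (uE.1 sA) mulmx1 -sigma_coords.
apply/uE/matrixP => i j; rewrite [RHS]mxE -sigma_frame -sA sE !coords_frame.
by rewrite trmx_delta map_delta_mx -rowE -colE !mxE.
Qed.

(* The C-trilinear alternating form on W with real part Omega1. *)
Definition Phi (Y Z U : Wc) : R[i] := Omega1 (val7 Y) (val7 Z) (val7 U)
  -i* Omega1 (cross X (val7 Y)) (val7 Z) (val7 U).

Lemma Phi_linear Z U : linear (fun Y : Wc => Phi Y Z U : R[i]^o).
Proof.
move=> [p q] Y1 Y2; rewrite /Phi val7D val7Z /=.
have OD (a c : R) (v1 v2 v3 v4 v5 : V7) :
    Omega1 (a *: v1 + c *: v2 + v3) v4 v5 =
    a * Omega1 v1 v4 v5 + c * Omega1 v2 v4 v5 + Omega1 v3 v4 v5.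
  by rewrite -!npolar_cross !crossDl !crossZl !npolarDl !npolarZl.
rewrite !crossDr !crossZr cross_cross_orth ?npolar_val7 // !OD.
have ON (v4 v5 v : V7) : Omega1 (- v) v4 v5 = - Omega1 v v4 v5.
  by rewrite -!npolar_cross crossNl npolarNl.
rewrite !ON.
by apply/eqP; rewrite eq_complex /=; apply/andP; split; apply/eqP; ring.
Qed.

Lemma Phi_rot Y Z U : Phi Y Z U = Phi Z U Y.
Proof.
rewrite /Phi Omega1_rot Omega1_crossC ?npolar_val7 //.
by rewrite [in X in _ -i* X]Omega1_rot.
Qed.

Lemma Phi_swap Y Z U : Phi Y Z U = - Phi Z Y U.
Proof.
have ON (v1 v2 v3 : V7) : Omega1 v1 v2 v3 = - Omega1 v2 v1 v3.
  by rewrite -!npolar_cross crossC npolarNl.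
rewrite /Phi ON Omega1_crossC ?npolar_val7 // [X in _ -i* X]ON.
by apply/eqP; rewrite eq_complex /= !eqxx.
Qed.

Lemma Phi_same Y U : Phi Y Y U = 0.
Proof.
have := Phi_swap Y Y U; case: (Phi Y Y U) => x y [xN yN].
by apply/eqP; rewrite eq_complex /=; apply/andP; split; apply/eqP; lra.
Qed.

Lemma Phi_frame_neq0 : Phi (frame ord0) (frame 1) (frame ord_max) != 0.
Proof.
rewrite /Phi !val7_frame eq_complex /= negb_and; apply/orP; right.
by rewrite oppr_eq0.
Qed.

(** An alternating trilinear form on a complex 3-space is a multiple of the determinant: of the 27
    terms of the expansion, the six with distinct slots survive. *)
Lemma Phi_det Y Z U : Phi Y Z U =
  \det (\matrix_(i, j) [:: coords Y; coords Z; coords U]`_j i 0) *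
  Phi (frame ord0) (frame 1) (frame ord_max).
Proof.
pose f0 := frame ord0; pose f1 := frame 1; pose f2 := frame ord_max.
have DE V : V = coords V ord0 0 *: f0 +
    (coords V 1 0 *: f1 + coords V ord_max 0 *: f2).
  rewrite -{1}[V]coordsK /uncoords !big_ord_recl big_ord0 addr0.
  have -> : lift ord0 ord0 = 1 :> 'I_3 by apply/val_inj.
  by have -> : lift ord0 (lift ord0 ord0) = ord_max :> 'I_3 by apply/val_inj.
have lin1 (c0 c1 c2 : R[i]) V W : Phi (c0 *: f0 + (c1 *: f1 + c2 *: f2)) V W =
    c0 * Phi f0 V W + (c1 * Phi f1 V W + c2 * Phi f2 V W).
  pose L : {linear Wc -> R[i]^o} := HB.pack (fun Y : Wc => Phi Y V W : R[i]^o)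
    (GRing.isLinear.Build _ _ _ _ _ (Phi_linear V W)).
  rewrite -[LHS]/(L (c0 *: f0 + (c1 *: f1 + c2 *: f2))).
  rewrite (linearD L (c0 *: f0)) (linearD L (c1 *: f1)).
  by rewrite !(linearZ_LR L).
have lin2 (c0 c1 c2 : R[i]) V W : Phi V (c0 *: f0 + (c1 *: f1 + c2 *: f2)) W =
    c0 * Phi V f0 W + (c1 * Phi V f1 W + c2 * Phi V f2 W).
  by rewrite Phi_rot lin1 -!(Phi_rot V).
have lin3 (c0 c1 c2 : R[i]) V W : Phi V W (c0 *: f0 + (c1 *: f1 + c2 *: f2)) =
    c0 * Phi V W f0 + (c1 * Phi V W f1 + c2 * Phi V W f2).
  by rewrite Phi_rot lin2 -!(Phi_rot V W).
have same2 V W : Phi V W W = 0 by rewrite Phi_rot Phi_same.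
have same3 V W : Phi V W V = 0 by rewrite -Phi_rot Phi_same.
rewrite {1}[Y]DE {1}[Z]DE {1}[U]DE.
rewrite !lin1 !lin2 !lin3 !Phi_same !same2 !same3.
(* Odd permutations of the frame become cyclic ones up to sign, and cyclic ones are then rotated to
   [Phi f0 f1 f2]. *)
rewrite (Phi_swap f0 f2) (Phi_swap f1 f0) (Phi_swap f2 f1).
rewrite (Phi_rot f2 f0 f1) -(Phi_rot f0 f1 f2) det_mx33.
move: (coords Y) (coords Z) (coords U) (Phi f0 f1 f2) => y z u t.
rewrite !mxE /=; ring.
Qed.

Lemma Phi_lfun (f : 'End(Wc)) Y Z U :
  Phi (f Y) (f Z) (f U) = lfun_det f * Phi Y Z U.
Proof.
rewrite Phi_det [in RHS]Phi_det lfun_det_mx mulrA -det_mulmx.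
congr (\det _ * _).
apply/matrixP => i j; rewrite [LHS]mxE [RHS]mxE !lfun_mx_mul.
have -> :
    [:: lfun_mx f *m coords Y; lfun_mx f *m coords Z; lfun_mx f *m coords U]`_j =
    lfun_mx f *m [:: coords Y; coords Z; coords U]`_j by case: j => -[|[|[|]]].
by rewrite mxE; apply: eq_bigr => k _; congr (_ * _); rewrite mxE.
Qed.

(** The identity on the line of X plus f on its orthogonal. The entries are affine in f, with
    constant part X X^T. *)
Definition extend (f : 'End(Wc)) : 'M[R]_7 := \matrix_(i, j)
  (X j 0 * X i 0 + val7 (f (inj7 (delta_mx j 0))) i 0).

Lemma extend_mul f v : extend f *m v = npolar X v *: X + val7 (f (inj7 v)).
Proof.
have val7_real (a : R) Y Z : val7 (a%:C *: Y + Z) = a *: val7 Y + val7 Z.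
  by rewrite val7D val7Z /= scale0r addr0.
pose h v := npolar X v *: X + val7 (f (inj7 v)).
have h_lin : linear h.
  move=> a u w; have fE : f (inj7 (a *: u + w)) =
    a%:C *: (f (inj7 u) : Wc) + f (inj7 w) :> Wc by rewrite inj7P linearP.
  rewrite /h fE val7_real.
  rewrite npolarDr npolarZr scalerDl scalerDr scalerA -!addrA; congr (_ + _).
  by rewrite addrCA.
pose hL : {linear V7 -> V7} := HB.pack h (GRing.isLinear.Build _ _ _ _ _ h_lin).
rewrite -[RHS]/(hL v) -(mul_matrix_lin hL v); congr (_ *m _).
apply/matrixP => i j; rewrite [LHS]mxE [RHS]mxE -[hL _]/(h _) /h npolar_delta.
by rewrite [RHS]mxE; congr (_ + _); rewrite mxE.
Qed.

Lemma extend_val7 f Y : extend f *m val7 Y = val7 (f Y).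
Proof. by rewrite extend_mul npolar_val7 scale0r add0r val7K. Qed.

Lemma inj7X : inj7 X = 0.
Proof.
apply: val7_inj; rewrite inj7K -/(nform X) hX scale1r subrr.
by rewrite [RHS](linear0 vsval).
Qed.

Lemma extend_X f : extend f *m X = X.
Proof.
rewrite extend_mul -/(nform X) hX scale1r inj7X linear0.
by rewrite [val7 0](linear0 vsval) addr0.
Qed.

Lemma vec_split v : v = npolar X v *: X + val7 (inj7 v).
Proof. by rewrite inj7K addrC subrK. Qed.

Lemma extend_comp (f g : 'End(Wc)) : extend (f \o g)%VF = extend f *m extend g.
Proof.
apply: mulmx_ext => v; rewrite -mulmxA (vec_split v) !mulmxDr -!scalemxAr.
by rewrite !extend_X !extend_val7 comp_lfunE.
Qed.

Lemma extend1 : extend \1%VF = 1%:M.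
Proof.
by apply: mulmx_ext => v; rewrite extend_mul id_lfunE mul1mx -vec_split.
Qed.

(** Forwards, the imaginary part of sigma gives the Kähler form and the real part of [Phi_lfun]
    gives Omega1, as [isotropyP] requires. Backwards, the norm and the cross product give sigma, and
    [Phi], invariant and nonzero on the frame, forces det f = 1. *)
Lemma SU_extend (f : 'End(Wc)) :
  SU (U := Wc) (@sigma R X) f <-> isotropy X (extend f).
Proof.
have tP v : npolar X v = 0 -> exists Y, v = val7 Y.
  by move=> v0; exists (inj7 v); rewrite inj7K v0 scale0r subr0.
split=> [[sf df]|[gG _]].
  apply: isotropyP => // [|v w|v w u]; first exact: extend_X.
    move=> /tP[Y ->] /tP[Z ->]; rewrite !extend_val7.
    by have := sf Y Z; rewrite !sigmaE => -[_ /oppr_inj].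
  move=> /tP[Y ->] /tP[Z ->] /tP[U ->]; rewrite !extend_val7.
  by have := Phi_lfun f Y Z U; rewrite df mul1r => -[].
have gJ Y : cross X (val7 (f Y)) = extend f *m cross X (val7 Y).
  by rewrite -(G_Omega1_cross gG) extend_X extend_val7.
split=> [Y Z|].
  rewrite !sigmaE gJ -!extend_val7.
  by rewrite !(G_Omega1_npolar gG).
apply: (mulIf Phi_frame_neq0); rewrite -Phi_lfun mul1r /Phi gJ -!extend_val7.
by rewrite !gG.2.
Qed.

Lemma isotropy_J g v : isotropy X g -> g *m cross X v = cross X (g *m v).
Proof. by move=> [gG gX]; rewrite -(G_Omega1_cross gG) gX. Qed.

Lemma isotropy_perp g v :
  isotropy X g -> npolar X v = 0 -> npolar X (g *m v) = 0.
Proof. by move=> [gG gX] v0; rewrite -{1}gX (G_Omega1_npolar gG). Qed.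

(** The map Y |-> g Y is C-linear on W because an isotropy element commutes with [cross X]; only
    then does [linfun] represent it. *)
Lemma restrictionE g Y : isotropy X g ->
  val7 (restriction hJ g Y) = g *m val7 Y.
Proof.
move=> gI; pose h (Y : Wc) : Wc := vsproj (perp X) (g *m val7 Y).
have hE Z : val7 (h Z) = g *m val7 Z.
  by rewrite /val7 /h vsprojK // mem_perp isotropy_perp // npolar_val7.
have h_lin : linear h.
  move=> z U V; apply: val7_inj; rewrite val7D val7Z !hE val7D val7Z.
  by rewrite !mulmxDr -!scalemxAr isotropy_J.
pose hL : {linear Wc -> Wc} := HB.pack h (GRing.isLinear.Build _ _ _ _ _ h_lin).
by rewrite -[restriction hJ g]/(linfun hL) lfunE -hE.
Qed.

Lemma restrictionK g : isotropy X g -> extend (restriction hJ g) = g.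
Proof.
move=> gI; apply: mulmx_ext => v; rewrite (vec_split v) !mulmxDr -!scalemxAr.
by rewrite extend_X extend_val7 restrictionE // gI.2.
Qed.

(** Matrix of the restriction of g, given by a formula that is R-linear in g on all of M_7(R): it
    provides the ambient extension needed for smoothness. *)
Definition frame_mx g : 'M[R[i]]_3 :=
  \matrix_(i, j) coords (inj7 (g *m b j)) i 0.

Lemma lfun_mx_restriction g : isotropy X g ->
  lfun_mx (restriction hJ g) = frame_mx g.
Proof.
move=> gI; apply/matrixP => i j; rewrite [LHS]mxE [RHS]mxE -val7_frame.
by rewrite -restrictionE // val7K.
Qed.

End Coordinates.

End TangentSpace.

(** * Lie groups and local sections *)

Local Transparent Omega1.

Section SmoothTools.
Variables (R : realType) (V : vectType R).
Implicit Types (O : set V) (f g : V -> R).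

Lemma smoothR_scale O c f : smoothR O f -> smoothR O (fun x => c * f x).
Proof. by move=> fS; apply: smoothR_mul fS; exact: smoothR_cst. Qed.

Lemma smoothR_sub O f g : smoothR O f -> smoothR O g ->
  smoothR O (fun x => f x - g x).
Proof.
move=> fS gS; under eq_fun do rewrite -mulN1r.
by apply: smoothR_add => //; exact: smoothR_scale.
Qed.

Lemma smoothR_sum O I (r : seq I) (F : I -> V -> R) :
  (forall i, smoothR O (F i)) -> smoothR O (fun x => \sum_(i <- r) F i x).
Proof.
move=> FS; elim: r => [|i r IH].
  by under eq_fun do rewrite big_nil; exact: smoothR_cst.
by under eq_fun do rewrite big_cons; exact: smoothR_add.
Qed.

Lemma smoothR_linear O (h : V -> R) : linear (h : V -> R^o) -> smoothR O h.
Proof.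
move=> h_lin; pose hL : {linear V -> R^o} :=
  HB.pack (h : V -> R^o) (GRing.isLinear.Build R V R^o _ (h : V -> R^o) h_lin).
exact: (smoothR_lin O hL).
Qed.

Lemma linear_mx_sum m n (l : {linear 'M[R]_(m, n) -> R^o}) A :
  l A = \sum_i \sum_j A i j * l (delta_mx i j).
Proof.
rewrite {1}[A]matrix_sum_delta linear_sum; apply: eq_bigr => i _.
by rewrite linear_sum; apply: eq_bigr => j _; rewrite linearZ.
Qed.

Lemma smoothR_mx O m n (F : V -> 'M[R]_(m, n)) :
  (forall i j, smoothR O (fun x => F x i j)) ->
  forall l : {linear 'M[R]_(m, n) -> R^o}, smoothR O (l \o F).
Proof.
move=> FS l; rewrite (_ : _ \o _ =
  fun x => \sum_i \sum_j F x i j * l (delta_mx i j)); last first.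
  by apply/funext => x; exact: linear_mx_sum.
do 2![apply: smoothR_sum => ?]; apply: smoothR_mul => //; exact: smoothR_cst.
Qed.

Lemma smoothR_mulmx O m n p (F : V -> 'M[R]_(m, n)) (B : 'M[R]_(n, p)) :
  (forall i j, smoothR O (fun x => F x i j)) ->
  forall i j, smoothR O (fun x => (F x *m B) i j).
Proof.
move=> FS i j; under eq_fun do rewrite mxE.
by apply: smoothR_sum => k; apply: smoothR_mul => //; exact: smoothR_cst.
Qed.

Lemma smoothR_comp_smoothR (U : vectType R) O (h : V -> U) (f : U -> R) :
  (forall l : {linear U -> R^o}, smoothR O (l \o h)) -> smoothR setT f ->
  smoothR O (f \o h).
Proof.
move=> hS; elim=> [c|l|{}f g _ Hf _ Hg|{}f g _ Hf _ Hg|{}f f0 _ Hf|{}f f0 _ Hf].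
- exact: smoothR_cst.
- exact: hS.
- exact: smoothR_add Hf Hg.
- exact: smoothR_mul Hf Hg.
- by apply: smoothR_inv Hf => x _; apply: f0.
- by apply: smoothR_sqrt Hf => x _; apply: f0.
Qed.

(** Closedness is tracked through smooth equations because these pull back along maps with smooth
    components. *)
Definition zero_set (A : set V) := exists (I : Type) (h : I -> V -> R),
  (forall i, smoothR setT (h i)) /\ A = [set x | forall i, h i x = 0].

Lemma zero_set_closed (A : set V) : zero_set A -> vclosed A.
Proof. by move=> [I [h [hS ->]]]; exact: vclosed_eq. Qed.

Lemma zero_setI (A B : set V) : zero_set A -> zero_set B -> zero_set (A `&` B).
Proof.
move=> [I [h [hS ->]]] [J [k [kS ->]]]; exists (I + J)%type.
exists (fun s => match s with inl i => h i | inr j => k j end).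
split; first by case.
apply/seteqP; split=> [x [xh xk] [i|j] //|x xhk].
by split=> i; [exact: (xhk (inl i))|exact: (xhk (inr i))].
Qed.

End SmoothTools.

(** * Transport of a Lie group structure along an injective smooth homomorphism *)

Section Transport.
Variables (R : realType) (V U : vectType R).

Lemma zero_set_preimage (e : U -> V) (A : set V) :
  (forall l : {linear V -> R^o}, smoothR setT (l \o e)) ->
  zero_set A -> zero_set (e @^-1` A).
Proof.
move=> eS [I [h [hS ->]]]; exists I, (fun i => h i \o e); split=> // i.
exact: smoothR_comp_smoothR.
Qed.

Variables (mulV : V -> V -> V) (oneV : V) (mulU : U -> U -> U) (oneU : U).
Variables (A : set V) (B : set U) (e : U -> V) (rho rho0 : V -> U).
Hypotheses (Agrp : closed_group mulV oneV A) (A0 : zero_set A).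
Hypothesis BE : forall u, B u <-> A (e u).
Hypothesis eM : forall u v, e (mulU u v) = mulV (e u) (e v).
Hypothesis e1 : e oneU = oneV.
Hypothesis e_inj : injective e.
Hypothesis rhoK : forall a, A a -> e (rho a) = a.
Hypothesis rho_rho0 : forall a, A a -> rho a = rho0 a.
Hypothesis eS : forall l : {linear V -> R^o}, smoothR setT (l \o e).
Hypothesis rho0S : forall l : {linear U -> R^o}, smoothR setT (l \o rho0).

Lemma closed_group_transport : closed_group mulU oneU B.
Proof.
have [Aone Amul Ainv _] := Agrp; split.
- by apply/BE; rewrite e1.
- by move=> u v /BE Au /BE Av; apply/BE; rewrite eM; exact: Amul.
- move=> u /BE /Ainv[a [Aa ua au]]; exists (rho a).
  by split; [apply/BE|apply: e_inj|apply: e_inj]; rewrite ?eM ?rhoK // e1.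
- apply: zero_set_closed; have -> : B = e @^-1` A.
    by apply/seteqP; split=> u /BE.
  exact: zero_set_preimage.
Qed.

(** The map [rho0] is a globally smooth representative of [rho], which is controlled on A alone. *)
Lemma smooth_rho : smooth_on A rho.
Proof.
move=> a Aa; have [P [F [oP Pa FS FE]]] := smooth_on_smoothR rho0S Aa.
by exists P, F; split=> // b Ab Ob; rewrite rho_rho0 // FE.
Qed.

Lemma rho_in a : A a -> B (rho a).
Proof. by move=> Aa; apply/BE; rewrite rhoK. Qed.

Lemma lie_group_iso_transport :
  lie_group_iso mulV oneV A mulU oneU B rho /\
  lie_group_iso mulU oneU B mulV oneV A e.
Proof.
have Bgrp := closed_group_transport; have [_ Amul _ _] := Agrp.
have rhoe u : B u -> rho (e u) = u.
  by move=> /BE Au; apply: e_inj; rewrite rhoK.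
have eS' : smooth_on B e by exact: smooth_on_smoothR.
split; split=> //.
- split=> [a /rho_in //|a a' /set_mem Aa /set_mem Aa' aa'|u Bu].
    by rewrite -(rhoK Aa) aa' rhoK.
  by exists (e u); [exact/BE|exact: rhoe].
- by move=> a a' Aa Aa'; apply: e_inj; rewrite eM !rhoK //; exact: Amul.
- by split; [exact: smooth_rho|exists e; split].
- split=> [u /BE //|u u' _ _ /e_inj //|a Aa].
  by exists (rho a); [exact: rho_in|exact: rhoK].
- by split=> //; exists rho; split=> //; exact: smooth_rho.
Qed.

End Transport.

Section LocalSections.
Variable R : realType.
Local Notation V7 := 'cV[R]_7.

(** By [G_Omega1P] the group is cut out by one polynomial equation for each triple of vectors, the
    unit condition being a consequence. *)
Lemma zero_set_G : zero_set (@G_Omega1 R).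
Proof.
exists (V7 * V7 * V7)%type, (fun t g =>
  Omega1 (g *m t.1.1) (g *m t.1.2) (g *m t.2) - Omega1 t.1.1 t.1.2 t.2).
split.
  move=> t; apply: smoothR_sub; last exact: smoothR_cst.
  have ES m (Y : V7) : smoothR setT (fun g : 'M[R]_7 => (g *m Y) m 0).
    by apply: smoothR_linear => a g h; rewrite mulmxDl -scalemxAl !mxE.
  have WS i j k : smoothR setT (fun g : 'M[R]_7 =>
      ewedge i j k (g *m t.1.1) (g *m t.1.2) (g *m t.2)).
    under eq_fun do rewrite ewedgeE.
    by do ![apply: smoothR_sub|apply: smoothR_add|apply: smoothR_mul|exact: ES].
  by do ![apply: smoothR_sub|apply: smoothR_add|exact: WS].
apply/seteqP; split=> [g [_ gO] t|g gO]; first by rewrite gO subrr.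
apply/G_Omega1P => Y Z U; apply/eqP; rewrite -subr_eq0; apply/eqP.
exact: (gO (Y, Z, U)).
Qed.

Lemma zero_set_isotropy (X : V7) : zero_set (isotropy X).
Proof.
apply: zero_setI; first exact: zero_set_G.
exists 'I_7, (fun i g => (g *m X) i 0 - X i 0); split.
  move=> i; apply: smoothR_sub; last exact: smoothR_cst.
  by apply: smoothR_linear => a g h; rewrite mulmxDl -scalemxAl !mxE.
apply/seteqP; split=> [g /= gX i|g gX]; first by rewrite gX subrr.
by apply/colP => i; apply/eqP; rewrite -subr_eq0; apply/eqP/gX.
Qed.

Lemma closed_group_G : closed_group mulmx 1%:M (@G_Omega1 R).
Proof.
split; [exact: G_Omega1_1|by move=> g h; exact: G_Omega1_mul| |].
  move=> g gG; exists (invmx g); split; first exact: G_Omega1_inv.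
    by rewrite mulmxV //; case: gG.
  by rewrite mulVmx //; case: gG.
apply: zero_set_closed; exact: zero_set_G.
Qed.

Lemma closed_group_isotropy (X : V7) : closed_group mulmx 1%:M (isotropy X).
Proof.
split.
- by split; [exact: G_Omega1_1|rewrite mul1mx].
- move=> g h [gG gX] [hG hX]; split; first exact: G_Omega1_mul.
  by rewrite -mulmxA hX.
- move=> g [gG gX]; have gU : g \in unitmx by case: gG.
  exists (invmx g); rewrite mulmxV // mulVmx //; split=> //.
  by split; [exact: G_Omega1_inv|rewrite -{1}gX mulKmx].
- apply: zero_set_closed; exact: zero_set_isotropy.
Qed.

Variable p : V7.
Let O := [set z : V7 | 0 < npolar p z + 2^-1].

(** On O one has n(p, z) > -1/2, which keeps 1 + n(p, z) away from 0 and the radicand (1 + 2 n(p,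
    z))/3 positive. *)
Lemma smoothR_axis (l : {linear V7 -> R^o}) : smoothR O (l \o axis p).
Proof.
have pS : smoothR O (npolar p) by exact: (smoothR_lin O (npolar p)).
rewrite (_ : _ \o _ = fun z => (1 + npolar p z)^-1 *
  (Num.sqrt ((1 + 2 * npolar p z) * 3^-1) * (l p + l z) +
   (Num.sqrt 3 / 3) * l (cross p z))); last first.
  apply/funext => z; rewrite /= /axis.
  by rewrite linearZ linearD linearZ linearD linearZ.
apply: smoothR_mul.
  apply: smoothR_inv; last by apply: smoothR_add => //; exact: smoothR_cst.
  by move=> z; rewrite /O /= => ?; rewrite gt_eqF //; lra.
apply: smoothR_add; last first.
  apply/smoothR_scale/smoothR_linear => a u v.
  by rewrite crossDr crossZr linearD linearZ.
apply: smoothR_mul; last first.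
  by apply: smoothR_add; [exact: smoothR_cst|exact: smoothR_lin].
apply: smoothR_sqrt.
  by move=> z; rewrite /O /= => ?; rewrite mulr_gt0 ?invr_gt0 //; lra.
apply: smoothR_mul; last exact: smoothR_cst.
by apply: smoothR_add; [exact: smoothR_cst|exact: smoothR_scale].
Qed.

Lemma smoothR_rot120_axis (i j : 'I_7) :
  smoothR O (fun z => rot120 (axis p z) i j).
Proof.
have AS (h : V7 -> R) : linear (h : V7 -> R^o) ->
    smoothR O (fun z => h (axis p z)).
  move=> h_lin; pose hL : {linear V7 -> R^o} := HB.pack (h : V7 -> R^o)
    (GRing.isLinear.Build R V7 R^o _ (h : V7 -> R^o) h_lin).
  exact: (smoothR_axis hL).
have CS k : smoothR O (fun z => axis p z k 0).
  by apply: (AS (fun u => u k 0)) => a u v; rewrite !mxE.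
have rE u : rot120 u i j = - 2^-1 * (i == j)%:R + 3 / 2 * (u i 0 * u j 0) +
    Num.sqrt 3 / 2 * Omega1 u (delta_mx j 0) (delta_mx i 0).
  by rewrite !mxE big_ord1 mxE.
under eq_fun do rewrite rE.
apply: smoothR_add; last first.
  apply: smoothR_scale.
  apply: (AS (fun u => Omega1 u (delta_mx j 0) (delta_mx i 0))) => a u v.
  by rewrite -!npolar_cross crossDl crossZl npolarDl npolarZl.
apply: smoothR_add; first exact: smoothR_cst.
by apply: smoothR_scale; apply: smoothR_mul; exact: CS.
Qed.

End LocalSections.

(** * The sphere as a homogeneous space *)

Section Quotient.
Variable R : realType.
Local Notation V7 := 'cV[R]_7.

Lemma local_section (X y : V7) : nform X = 1 -> nform y = 1 ->
  exists (O : set V7) (s : V7 -> 'M[R]_7),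
    [/\ vopen O, O y, smooth_on (@S6 R `&` O) s
      & forall z, @S6 R z -> O z -> G_Omega1 (s z) /\ s z *m X = z].
Proof.
move=> hX hy; have [p [hp pX py]] := unit_orth2 X y.
pose O := [set z : V7 | 0 < npolar p z + 2^-1].
(* A fixed rotation takes X to p, and one depending smoothly on z takes p to z; since p is
   orthogonal to y, the point y lies in O. *)
pose s z := rot120 (axis p z) *m rot120 (axis X p).
have oO : vopen O.
  apply: vopen_gt; apply: smoothR_add; last exact: smoothR_cst.
  exact: (smoothR_lin setT (npolar p)).
have [|G1 e1] := @rot120_axis_G _ X p hX hp; first by rewrite npolarC pX; lra.
exists O, s; split=> //.
- by rewrite /O /= py add0r invr_gt0.
- move=> z [_ Oz]; exists O, s; split=> //.
  apply: class_C_chart => //; apply: smoothR_mx => i j.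
  by apply: smoothR_mulmx => k l; exact: smoothR_rot120_axis.
- move=> z hz; rewrite /O /= => Oz.
  have [|G2 e2] := @rot120_axis_G _ p z hp hz; first lra.
  split; first exact: G_Omega1_mul.
  by rewrite -mulmxA; exact: etrans (congr1 (mulmx _) e1) e2.
Qed.

Lemma quotient_isotropy (X : V7) : nform X = 1 ->
  exists Phi : set 'M[R]_7 -> V7,
  (forall g, @G_Omega1 R g ->
     Phi (left_coset (V := 'M[R]_7) mulmx (isotropy X) g)
     = g *m X) /\
  quotient_diffeo (V := 'M[R]_7) (U := V7) mulmx 1%:M (@G_Omega1 R) (isotropy X)
    (@S6 R) Phi.
Proof.
move=> hX; pose coset := left_coset (V := 'M[R]_7) mulmx (isotropy X).
(* An arbitrary representative is applied to X; [PhiE] shows independence of the choice. A coset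
   contains its g, so the default 1 is never reached. *)
pose Phi (C : set 'M[R]_7) := xget 1%:M C *m X.
have PhiE g : Phi (coset g) = g *m X.
  have [|h [_ hX'] e] := @xgetPex _ (1%:M : 'M[R]_7) (coset g).
    exists (g *m 1%:M); exists 1%:M => //.
    by split; [exact: G_Omega1_1|rewrite mul1mx].
  by rewrite /Phi -e -mulmxA hX'.
exists Phi; split=> //; split.
- split; [exact: closed_group_G|exact: closed_group_isotropy|by move=> g []].
- split.
  + by move=> _ [g gG <-]; rewrite PhiE /S6 /= nform_G.
  + move=> _ _ /set_mem[g gG <-] /set_mem[h hG <-]; rewrite !PhiE => gh.
    have gU : g \in unitmx by case: gG.
    have hU : h \in unitmx by case: hG.
    have sub (g1 g2 : 'M[R]_7) : G_Omega1 g1 -> G_Omega1 g2 ->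
        g1 *m X = g2 *m X -> coset g1 `<=` coset g2.
      move=> G1 G2 e _ [k [kG kX] <-]; have U2 : g2 \in unitmx by case: G2.
      exists (invmx g2 *m (g1 *m k)); last by rewrite mulKVmx.
      split.
        by apply: G_Omega1_mul; [exact: G_Omega1_inv|exact: G_Omega1_mul].
      by rewrite -!mulmxA kX e mulKmx.
    by apply/seteqP; split; exact: sub.
  + move=> y hy; have [g gG gX] := G_Omega1_transitive hX hy.
    by exists (coset g); [exists g|rewrite PhiE].
- move=> g gG; have gS (l : {linear V7 -> R^o}) :
      smoothR setT (l \o (fun g : 'M[R]_7 => g *m X)).
    apply: smoothR_linear => a u v.
    by rewrite /= mulmxDl -scalemxAl linearD linearZ.
  have [P [F [oP Pg FS FE]]] := smooth_on_smoothR gS gG.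
  by exists P, F; split=> // h hG Ph; rewrite -FE //= PhiE.
- move=> y hy; have [P [s [oP Py sS sP]]] := local_section hX hy.
  exists P, s; split=> // z hz Pz; have [sG sX] := sP z hz Pz.
  by split=> //; rewrite PhiE.
Qed.

End Quotient.

(** * The isotropy group as SU(W, sigma) and as the matrix group SU(3) *)

Section Isomorphisms.
Local Open Scope complex_scope.
Variables (R : realType) (X : 'cV[R]_7).
Hypothesis hX : nform X = 1.
Variable hJ : forall Y : TS6 X, Jcross X (Jcross X Y) = - Y.
Local Notation Wc := (cplx hJ).
Variable b : 'I_3 -> 'cV[R]_7.
Hypothesis b_perp : forall i, npolar X (b i) = 0.
Hypothesis b_norm : forall i j, npolar (b i) (b j) = (i == j)%:R.
Hypothesis b_J : forall i j, npolar (cross X (b i)) (b j) = 0.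
Hypothesis b_total : forall v, npolar X v = 0 ->
  v = \sum_i (npolar v (b i) *: b i +
              npolar v (cross X (b i)) *: cross X (b i)).
Hypothesis b_vol : Omega1 (cross X (b ord0)) (b 1) (b ord_max) != 0.
Local Notation mx_endo := (@mx_endo R X hJ b).
Local Notation frame_mx := (@frame_mx R X hJ b).
Local Notation extend := (@extend R X hJ).

Lemma mx_endo_linear :
  linear (mx_endo : realified 'M[R[i]]_3 -> realified 'End(Wc)).
Proof.
move=> a A B; apply/lfunP => Y.
rewrite [RHS](add_lfunE (a%:C *: mx_endo A)) scale_lfunE !mx_endoE //.
by rewrite -uncoords_linear mulmxDl scalemxAl.
Qed.

Lemma frame_mx_linear : linear (frame_mx : 'M[R]_7 -> realified 'M[R[i]]_3).
Proof.
move=> a g h; apply/matrixP => i j; rewrite [RHS]mxE [in RHS]mxE ![in RHS]mxE.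
rewrite mxE mulmxDl -scalemxAl inj7P //.
have -> := coords_linear hX b a%:C (inj7 hJ (g *m b j)) (inj7 hJ (h *m b j)).
by rewrite !mxE.
Qed.

Lemma smoothR_extend (l : {linear 'M[R]_7 -> R^o}) :
  smoothR setT (l \o (extend : realified 'End(Wc) -> 'M[R]_7)).
Proof.
apply: smoothR_mx => i j; under eq_fun do rewrite mxE.
apply: smoothR_add; first exact: smoothR_cst.
apply: smoothR_linear => a f g.
rewrite [in LHS](add_lfunE (a%:C *: f)) scale_lfunE.
by rewrite val7D // val7Z // /= scale0r addr0 !mxE.
Qed.

Lemma smoothR_linear_map (V U : vectType R) (h : V -> U) : linear h ->
  forall l : {linear U -> R^o}, smoothR setT (l \o h).
Proof.
by move=> h_lin l; apply: smoothR_linear => a u v; rewrite /= h_lin linearP.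
Qed.

Lemma extend_inj : injective extend.
Proof.
move=> f g e; apply/lfunP => Y; apply: val7_inj.
by rewrite -!extend_val7 // e.
Qed.

(** Transport along [extend], whose inverse on the isotropy group is [restriction]; the ambient
    representative of the latter is the R-linear map [mx_endo \o frame_mx]. *)
Lemma restriction_iso : lie_group_iso (V := 'M[R]_7) (U := realified 'End(Wc))
  mulmx 1%:M (isotropy X)
  (@comp_lfun _ Wc Wc Wc) \1%VF (SU (U := Wc) (@sigma R X)) (restriction hJ).
Proof.
have [] := @lie_group_iso_transport R 'M[R]_7 (realified 'End(Wc))
  mulmx 1%:M (@comp_lfun _ Wc Wc Wc) \1%VF (isotropy X)
  (SU (U := Wc) (@sigma R X)) extend (restriction hJ)
  (mx_endo \o frame_mx) => //.
- exact: closed_group_isotropy.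
- exact: zero_set_isotropy.
- exact: SU_extend b_vol.
- exact: extend_comp.
- exact: extend1.
- exact: extend_inj.
- by move=> g; exact: restrictionK.
- move=> g gI; rewrite /= -lfun_mx_restriction // lfun_mxK //.
- exact: smoothR_extend.
- apply: smoothR_linear_map => a g h /=; rewrite frame_mx_linear.
  exact: mx_endo_linear.
Qed.

Definition embed (A : 'M[R[i]]_3) : 'M[R]_7 := extend (mx_endo A).

Lemma embed_iso : lie_group_iso (V := realified 'M[R[i]]_3) (U := 'M[R]_7)
  mulmx 1%:M (@SU_mx R 3) mulmx 1%:M (isotropy X) embed.
Proof.
have [] := @lie_group_iso_transport R 'M[R]_7 (realified 'M[R[i]]_3)
  mulmx 1%:M mulmx 1%:M (isotropy X) (@SU_mx R 3) embed frame_mx frame_mx => //.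
- exact: closed_group_isotropy.
- exact: zero_set_isotropy.
- move=> A; exact: iff_trans (SU_mx_endo hX hJ b_perp b_norm b_J b_total A)
    (SU_extend hX b_perp b_norm b_J b_total b_vol (mx_endo A)).
- move=> A B; rewrite /embed -extend_comp //; congr extend.
  apply/lfunP => Y; rewrite comp_lfunE !(mx_endoE hX).
  by rewrite (uncoordsK hX) // mulmxA.
- apply: etrans (extend1 hX hJ); congr extend; apply/lfunP => Y.
  by rewrite (mx_endoE hX) id_lfunE mul1mx (coordsK hX).
- have eK : cancel mx_endo (@lfun_mx R X hJ b) by exact: mx_endoK.
  by move=> A B /extend_inj /(can_inj eK).
- move=> g gI; rewrite /embed -lfun_mx_restriction // lfun_mxK //.
  exact: restrictionK.
- have -> : embed = (extend : realified 'End(Wc) -> _) \o mx_endo by [].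
  move=> l; apply: (smoothR_comp_smoothR
    (h := mx_endo : realified _ -> realified _)
    (f := l \o extend)); last exact: smoothR_extend.
  exact/smoothR_linear_map/mx_endo_linear.
- exact/smoothR_linear_map/frame_mx_linear.
Qed.

End Isomorphisms.


Theorem proposition5p2 (R : realType) (X : 'cV[R]_7) (hX : nform X = 1) :
  [/\ \dim (perp X) = 6%N,
      (forall Y : TS6 X, vsval (Jcross X Y) = cross X (vsval Y))
    & exists hJ : forall Y : TS6 X, Jcross X (Jcross X Y) = - Y,
      let Wc : vectType R[i] := cplx hJ in
      [/\ \dim {:Wc} = 3%N,
          exists s : {hermitian_sym Wc for Num.conj},
            (forall Y Z : Wc, s Y Z = sigma Y Z) /\ nondegenerate s,
          (forall g, isotropy X g ->
             forall Y : TS6 X, vsval (restriction hJ g Y : TS6 X) = g *m vsval Y),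
          lie_group_iso (V := 'M[R]_7) (U := realified 'End(Wc))
            mulmx 1%:M (isotropy X)
            (@comp_lfun _ Wc Wc Wc) \1%VF (SU (U := Wc) (@sigma R X))
            (restriction hJ)
        & exists iota : 'M[R[i]]_3 -> 'M[R]_7,
            lie_group_iso (V := realified 'M[R[i]]_3) (U := 'M[R]_7)
              mulmx 1%:M (@SU_mx R 3) mulmx 1%:M (isotropy X) iota /\
            exists Phi : set 'M[R]_7 -> 'cV[R]_7,
              (forall g, @G_Omega1 R g ->
                 Phi (left_coset (V := 'M[R]_7) mulmx (iota @` @SU_mx R 3) g)
                 = g *m X) /\
              quotient_diffeo (V := 'M[R]_7) (U := 'cV[R]_7)
                mulmx 1%:M (@G_Omega1 R) (iota @` @SU_mx R 3) (@S6 R) Phi]].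
Proof.
have [b [bp bn bJ bt bv]] := unitary_frame hX.
split; [exact: dim_perp|exact: vsval_Jcross|].
exists (Jcross_Jcross hX); set hJ := Jcross_Jcross hX; move=> Wc; split.
- exact: (size_basis (frame_basis hX hJ bp bn bJ bt)).
- exact: hermitian_sigma.
- by move=> g gI Y; exact: (@restrictionE R X hJ g Y gI).
- exact: (restriction_iso hX hJ bp bn bJ bt bv).
exists (embed hJ b); have iI := embed_iso hX hJ bp bn bJ bt bv; split=> //.
have [_ _ [iF _ iS] _ _] := iI.
(* The embedded SU(3) is the whole isotropy group, so the quotient by it is the one already
   identified with the sphere. *)
have -> : embed hJ b @` @SU_mx R 3 = isotropy X.
  by apply/seteqP; split=> [_ [A SA <-]|g /iS //]; exact: iF.
exact: quotient_isotropy.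
Qed.
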